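(* Let $v^{\mathrm{in}}\in\mathbb{L}^2(\mathcal{O})$ and, for $N\in\mathbb{N}$ and Borel sets $A\subset\mathbb{L}^2(\mathcal{O})$, let $$\mu^{1/2,N}_{\tau,\mathcal{D}}(v^{\mathrm{in}};A)=\frac1N\sum_{n=0}^{N-1}\mathbb{P}\big(\Pi_{\mathcal{D}}\mathfrak{S}^{1/2}(n,v^{\mathrm{in}})\in A\big).$$ There exist a subsequence $(N_k)_{k\in\mathbb{N}}$ and a probability measure $\mu^{1/2}_{\tau,\mathcal{D}}(v^{\mathrm{in}};\cdot)$ on $\mathbb{L}^2(\mathcal{O})$ such that for all $f\in C_b(\mathbb{L}^2(\mathcal{O}))$: $$\int_{\mathbb{L}^2(\mathcal{O})}f(v)\,\mu^{1/2,N_k}_{\tau,\mathcal{D}}(v^{\mathrm{in}};dv)\ \longrightarrow\ \int_{\mathbb{L}^2(\mathcal{O})}f(v)\,\mu^{1/2}_{\tau,\mathcal{D}}(v^{\mathrm{in}};dv)\qquad (k\to\infty).$$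
   Context: Setting. $(\Omega,(\mathcal{F}_t)_{t\ge0},\mathcal{F},\mathbb{P})$ is a filtered probability space satisfying the usual conditions and $W$ is a real-valued $(\mathcal{F}_t)$-Wiener process. $\mathcal{O}\subset\mathbb{R}^d$ is a bounded polygonal domain. $p\in(1,\infty)$, $p'=p/(p-1)$, $p\wedge p'=\min(p,p')$, $\kappa\ge0$. For $A\in\mathbb{R}^{d\times d}$ (with Euclidean norm $|A|$), $S(A)=(\kappa+|A|^2)^{(p-2)/2}A$ (with $S(0)=0$). $\mathbb{L}^2(\mathcal{O})$ is the space of $L^2$ vector fields $\mathcal{O}\to\mathbb{R}^d$, and $C_b(\mathbb{L}^2(\mathcal{O}))$ the space of (norm-)continuous bounded real functions on it; $(\cdot,\cdot)$ is the $L^2(\mathcal{O})$ pairing $\int_{\mathcal{O}}$ of (scalar, vector or matrix) functions. $\mathbb{W}^{k,\infty}_{\mathrm{div}}(\mathcal{O})$ is the $W^{k,\infty}$-closure of smooth vector fields on $\mathcal{O}$ with zero divergence. The data are deterministic and time-independent: $g\in\mathbb{W}^{2,\infty}_{\mathrm{div}}(\mathcal{O})$, $\sigma\in\mathbb{W}^{1,\infty}_{\mathrm{div}}(\mathcal{O})$. $\varepsilon g=\tfrac12(\nabla g+(\nabla g)^T)$ and $(\sigma\cdot\nabla)g=\sum_j\sigma_j\partial_jg$. Gradient Discretisation (GD). $\mathcal{D}=(X_{\mathcal{D},0},Y_{\mathcal{D}},\nabla_{\mathcal{D}},\varepsilon_{\mathcal{D}},\chi_{\mathcal{D}},\mathrm{div}_{\mathcal{D}},\Pi_{\mathcal{D}})$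 where $X_{\mathcal{D},0},Y_{\mathcal{D}}$ are finite-dimensional real vector spaces; $\nabla_{\mathcal{D}},\varepsilon_{\mathcal{D}}:X_{\mathcal{D},0}\to L^p(\mathcal{O})^{d\times d}$, $\mathrm{div}_{\mathcal{D}}:X_{\mathcal{D},0}\to L^p(\mathcal{O})$, $\Pi_{\mathcal{D}}:X_{\mathcal{D},0}\to L^2(\mathcal{O})^d$, $\chi_{\mathcal{D}}:Y_{\mathcal{D}}\to L^{p\wedge p'}(\mathcal{O})$ are linear; $\nabla_{\mathcal{D}},\varepsilon_{\mathcal{D}},\mathrm{div}_{\mathcal{D}},\Pi_{\mathcal{D}}$ moreover take values in $L^p\cap L^{p'}$, so that all pairings and constants below make sense. $\|\varepsilon_{\mathcal{D}}\cdot\|_{L^p(\mathcal{O})}$ is a norm on $X_{\mathcal{D},0}$. With $Y_{\mathcal{D},0}=\{q\in Y_{\mathcal{D}}:\int_{\mathcal{O}}\chi_{\mathcal{D}}q\,dx=0\}$, $\|\chi_{\mathcal{D}}\cdot\|_{L^{p\wedge p'}(\mathcal{O})}$ is a norm on $Y_{\mathcal{D},0}$. $E_{\mathcal{D},0}=\{v\in X_{\mathcal{D},0}:(\chi_{\mathcal{D}}q,\mathrm{div}_{\mathcal{D}}v)=0\ \forall q\in Y_{\mathcal{D},0}\}$, and $\Pi_{\mathcal{D}}$ is one-to-one on $E_{\mathcal{D},0}$. The $L^2$-projection $\mathcal{K}_{\mathcal{D}}:\mathbb{L}^2(\mathcal{O})\to E_{\mathcal{D},0}$ is defined by $(u-\Pi_{\mathcal{D}}\mathcal{K}_{\mathcal{D}}u,\Pi_{\mathcal{D}}\xi)=0$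 for all $\xi\in E_{\mathcal{D},0}$. For $r\in\{p,p'\}$ put $C_{\mathcal{D}}(r)=\sup_{v\in X_{\mathcal{D},0}\setminus\{0\}}\frac{\|\Pi_{\mathcal{D}}v\|_{L^r}+\|\mathrm{div}_{\mathcal{D}}v\|_{L^r}+\|\nabla_{\mathcal{D}}v\|_{L^r}}{\|\varepsilon_{\mathcal{D}}v\|_{L^r}}$, $C^{\mathrm{Sob}}_{\mathcal{D}}(r)=\sup_{z\in W^{1,r}(\mathcal{O})^d\setminus\{0\}}\frac{\|\varepsilon_{\mathcal{D}}\mathcal{K}_{\mathcal{D}}z\|_{L^r}}{\|z\|_{W^{1,r}}}$, and $\beta_{\mathcal{D}}(p)=\inf_{q\in Y_{\mathcal{D},0}\setminus\{0\}}\sup_{v\in X_{\mathcal{D},0}\setminus\{0\}}\frac{(\chi_{\mathcal{D}}q,\mathrm{div}_{\mathcal{D}}v)}{\|\chi_{\mathcal{D}}q\|_{L^{p\wedge p'}}(\|\varepsilon_{\mathcal{D}}v\|_{L^p}+\|\varepsilon_{\mathcal{D}}v\|_{L^{p'}})}$. Standing assumption: $\mathcal{D}$ is $\Gamma$-stable, i.e. for some $\Gamma\in[1,\infty)$: $C_{\mathcal{D}}(p)+C_{\mathcal{D}}(p')\le\Gamma$, $\beta_{\mathcal{D}}(p)\ge\Gamma^{-1}$, $C^{\mathrm{Sob}}_{\mathcal{D}}(p)+C^{\mathrm{Sob}}_{\mathcal{D}}(p')\le\Gamma$. Discrete noise form: $B^\sigma_{\mathcal{D}}(v,\xi)=\tfrac12(\sigma^T\nabla_{\mathcal{D}}v,\Pi_{\mathcal{D}}\xi)-\tfrac12(\Pi_{\mathcal{D}}v,\sigma^T\nabla_{\mathcal{D}}\xi)$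 for $v,\xi\in X_{\mathcal{D},0}$, where $(\sigma^T\nabla_{\mathcal{D}}v)_i=\sum_j\sigma_j(\nabla_{\mathcal{D}}v)_{ji}$ is the discrete counterpart of $(\sigma\cdot\nabla)v$. Algorithm. Given $v^{\mathrm{in}}\in\mathbb{L}^2(\mathcal{O})$ and a fixed time step $\tau>0$, $t_n=n\tau$, $\Delta_{n+1}W=W(t_{n+1})-W(t_n)$. Step 1 (initialisation): $(v^0_{\mathcal{D}},\pi^0_{\mathcal{D}})\in X_{\mathcal{D},0}\times Y_{\mathcal{D},0}$ solves $(\Pi_{\mathcal{D}}v^0_{\mathcal{D}},\Pi_{\mathcal{D}}\xi)+(\chi_{\mathcal{D}}\pi^0_{\mathcal{D}},\mathrm{div}_{\mathcal{D}}\xi)=(v^{\mathrm{in}},\Pi_{\mathcal{D}}\xi)$ for all $\xi\in X_{\mathcal{D},0}$ and $(\mathrm{div}_{\mathcal{D}}v^0_{\mathcal{D}},\chi_{\mathcal{D}}q)=0$ for all $q\in Y_{\mathcal{D},0}$. Step 2 (time-stepping): for $n\in\mathbb{N}_0$, $(v^{n+1}_{\mathcal{D}},\pi^{n+1}_{\mathcal{D}})\in X_{\mathcal{D},0}\times Y_{\mathcal{D},0}$ satisfies $\mathbb{P}$-a.s. for all $(\xi,q)\in X_{\mathcal{D},0}\times Y_{\mathcal{D},0}$ $$(\Pi_{\mathcal{D}}v^{n+1}_{\mathcal{D}}-\Pi_{\mathcal{D}}v^n_{\mathcal{D}},\Pi_{\mathcal{D}}\xi)+\tau(S(\varepsilon_{\mathcal{D}}v^{n+1/2}_{\mathcal{D}}+\varepsilon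 g),\varepsilon_{\mathcal{D}}\xi)-(\chi_{\mathcal{D}}\pi^{n+1}_{\mathcal{D}}-\chi_{\mathcal{D}}\pi^n_{\mathcal{D}},\mathrm{div}_{\mathcal{D}}\xi)=[B^\sigma_{\mathcal{D}}(v^{n+1/2}_{\mathcal{D}},\xi)+((\sigma\cdot\nabla)g,\Pi_{\mathcal{D}}\xi)]\Delta_{n+1}W,$$ $$(\mathrm{div}_{\mathcal{D}}v^{n+1/2}_{\mathcal{D}},\chi_{\mathcal{D}}q)=0,\qquad v^{n+1/2}_{\mathcal{D}}=\tfrac12(v^{n+1}_{\mathcal{D}}+v^n_{\mathcal{D}}).$$ The algorithm is well-posed (unique solutions). Solution operators: $\mathfrak{S}(n,v^{\mathrm{in}}):=v^n_{\mathcal{D}}\in E_{\mathcal{D},0}$, the velocity at index $n$ when initialised in $v^{\mathrm{in}}$, and $\mathfrak{S}^{1/2}(n,v^{\mathrm{in}}):=\tfrac12(\mathfrak{S}(n+1,v^{\mathrm{in}})+\mathfrak{S}(n,v^{\mathrm{in}}))$. *)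

(* Defs.v *)
From HB Require Import structures.
From mathcomp Require Import all_boot all_order all_algebra.
From mathcomp Require Import ring lra measurable_realfun.
From mathcomp Require Import all_classical all_reals all_analysis.

Set Implicit Arguments.
Unset Strict Implicit.
Unset Printing Implicit Defensive.

Import Order.TTheory GRing.Theory Num.Theory.
Import numFieldNormedType.Exports.

Local Open Scope classical_set_scope.
Local Open Scope ring_scope.

HB.instance Definition _ (R : realType) m n :=
  @isMeasurable.Build (sigma_display (@open 'M[R]_(m, n))) 'M[R]_(m, n)
    <<s @open 'M[R]_(m, n) >>
    (@sigma_algebra0 _ setT open) (@sigma_algebraC _ open)
    (@sigma_algebra_bigcup _ setT open).

Section borel_matrix.
Context {R : realType} {m n : nat}.

Lemma open_measurable_mx (U : set 'M[R]_(m, n)) : open U -> measurable U.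
Proof. exact: sub_sigma_algebra. Qed.

Lemma measurable_coord i j :
  measurable_fun [set: 'M[R]_(m, n)] (fun A => A i j).
Proof.
apply: (measurability _ (RGenOpens.measurableE R)).
move=> _ [_ [a [b ->] <-]]; rewrite setTI; apply: open_measurable_mx.
apply: open_comp; last exact: interval_open.
by move=> A _; exact: coord_continuous.
Qed.

Let rball (c : 'M[rat]_(m, n)) (e : R) : set 'M[R]_(m, n) :=
  ball (map_mx ratr c : 'M[R]_(m, n)) e.

Lemma mx_ball_rat (x : 'M[R]_(m, n)) (e : R) : 0 < e ->
  exists c r, rball c (ratr r) x /\ rball c (ratr r) `<=` ball x e.
Proof.
move=> e0.
have [r /[!in_itv]/= /andP[r0 re]] : exists q : rat, ratr q \in `]0, (e / 2)[.
  by apply: rat_in_itvoo; rewrite divr_gt0.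
have cP i j : exists q : rat, ratr q \in `](x i j - ratr r), (x i j + ratr r)[.
  by apply: rat_in_itvoo; rewrite ltrD2l gt0_cp.
pose c := \matrix_(i, j) projT1 (cid (cP i j)).
have bc : rball c (ratr r) x.
  split=> // i j; rewrite /ball/= !mxE/=.
  case: cid => q /=; rewrite in_itv/= => /andP[h1 h2].
  by rewrite ltr_distlC; apply/andP; split; lra.
exists c, r; split=> // y by_.
have xc : ball x (e / 2) (map_mx (ratr : rat -> R) c).
  by apply: ball_sym; exact: le_ball (ltW re) _ bc.
rewrite (splitr e); apply: (ball_triangle xc); exact: le_ball (ltW re) _ by_.
Qed.

Lemma measurable_fun_mx dsp (T : measurableType dsp) (D : set T)
    (f : T -> 'M[R]_(m, n)) :
  (forall i j, measurable_fun D (fun x => f x i j)) -> measurable_fun D f.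
Proof.
move=> mf mD; apply: (measurability (@open 'M[R]_(m, n)) erefl) => // _ [U oU <-].
have -> : U = \bigcup_(p : 'M[rat]_(m, n) * rat)
    (if `[< rball p.1 (ratr p.2) `<=` U >] then rball p.1 (ratr p.2) else set0).
  apply/seteqP; split=> [x Ux|x [p _]]; last by case: asboolP => // pU; exact: pU.
  have /nbhs_ballP[e /= e0 eU] : nbhs x U by exact: open_nbhs_nbhs.
  have [c [r [cx ce]]] := mx_ball_rat x e0.
  exists (c, r) => //=; case: asboolP => // -[]; exact: subset_trans eU.
rewrite preimage_bigcup setI_bigcupr.
apply: countable_bigcupT_measurable => // p.
case: asboolP => _; last by rewrite preimage_set0 setI0.
have [e0|e0] := ltP 0 (ratr p.2 : R); last first.
  rewrite (_ : rball _ _ = set0) ?preimage_set0 ?setI0//.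
  by apply/seteqP; split=> x // -[] /(le_lt_trans e0); rewrite ltxx.
have -> : D `&` f @^-1` rball p.1 (ratr p.2) = D `&` \bigcap_(ij in [set: 'I_m * 'I_n])
    (D `&` (fun x => f x ij.1 ij.2) @^-1` ball (ratr (p.1 ij.1 ij.2) : R) (ratr p.2)).
  apply/seteqP; split=> [x [Dx [_ fx]]|x [Dx fx]]; split=> //.
    by move=> -[i j] _; split=> //=; move: (fx i j); rewrite mxE.
  by split=> // i j; rewrite mxE; have [] := fx (i, j) I.
apply: measurableI => //; apply: fin_bigcap_measurable => //.
move=> -[i j] _; apply: mf => //; apply: open_measurable; exact: ball_open.
Qed.

End borel_matrix.

Section lebesgue_mx.
Context {R : realType}.

Definition consrv n (p : 'rV[R]_n * R) : 'rV[R]_n.+1 :=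
  row_mx (p.2%:M : 'rV_1) p.1.

Lemma measurable_consrv n : measurable_fun setT (@consrv n).
Proof.
apply: measurable_fun_mx => i j; rewrite /consrv.
have [k jk|k jk] := splitP (j : 'I_(1 + n)).
  apply: (eq_measurable_fun snd); last exact: measurable_snd.
  move=> -[v a] _; have -> : j = lshift n k by exact: val_inj.
  by rewrite (@row_mxEl _ 1 1 n) !ord1 mxE.
apply: (eq_measurable_fun ((fun v : 'rV_n => v 0 k) \o fst)); last first.
  by apply: measurableT_comp; [exact: measurable_coord|exact: measurable_fst].
move=> -[v a] _ /=; have -> : j = rshift 1 k by exact: val_inj.
by rewrite (@row_mxEr _ 1 1 n) ord1.
Qed.

Fixpoint lebesgue_rV (n : nat) : {measure set 'rV[R]_n -> \bar R} :=
  if n is n'.+1 then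
    measure_function_pushforward__canonical__measure_function_Measure
      (lebesgue_rV n' \x lebesgue_measure)%E (@measurable_consrv n')
  else dirac (0 : 'rV[R]_0).

Lemma lebesgue_rV_box n (a b : 'rV[R]_n) : (forall i, a 0 i <= b 0 i) ->
  lebesgue_rV n [set x | forall i, x 0 i \in `[a 0 i, b 0 i]] =
  (\prod_i (b 0 i - a 0 i))%:E.
Proof.
elim: n a b => [|n IH] a b ab.
  by rewrite /= /dirac indicE big_ord0 mem_set// => -[].
pose tl (v : 'rV[R]_n.+1) : 'rV[R]_n := \row_i v 0 (rshift 1 i).
pose box m (u v : 'rV[R]_m) := [set x : 'rV[R]_m | forall i, x 0 i \in `[u 0 i, v 0 i]].
have mbox m (u v : 'rV[R]_m) : measurable (box m u v).
  rewrite (_ : box m u v = \bigcap_(i in [set: 'I_m])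
      (fun x => x 0 i) @^-1` [set` `[u 0 i, v 0 i]]); last first.
    by apply/seteqP; split => [x + i _|x + i]; [exact|exact].
  apply: fin_bigcap_measurable => // i _; rewrite -[X in measurable X]setTI.
  by apply: measurable_coord.
have l0 : lshift n (0 : 'I_1) = 0 :> 'I_n.+1 by exact: val_inj.
rewrite /= /pushforward.
rewrite (_ : _ @^-1` _ = box n (tl a) (tl b) `*` [set` `[a 0 0, b 0 0]]); last first.
  apply/seteqP; split => [[v x] /= h|[v x] /= [h1 h2] i].
    split.
      by move=> i; have := h (rshift 1 i); rewrite /consrv (@row_mxEr _ 1 1 n) !mxE.
    by have := h (lshift n (0 : 'I_1)); rewrite /consrv (@row_mxEl _ 1 1 n) mxE/= l0.
  have [k jk|k jk] := splitP (i : 'I_(1 + n)).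
    have -> : i = lshift n k by exact: val_inj.
    rewrite /consrv (@row_mxEl _ 1 1 n) !ord1 mxE/=.
    by rewrite l0.
  have -> : i = rshift 1 k by exact: val_inj.
  by rewrite /consrv (@row_mxEr _ 1 1 n); have := h1 k; rewrite !mxE.
rewrite product_measure1E//; last exact: mbox.
rewrite IH => [|i]; last by rewrite !mxE ab.
rewrite [X in (_ * X)%E](_ : _ = lebesgue_measure [set` `[a 0 0, b 0 0]])//.
rewrite lebesgue_measure_itv/= lte_fin big_ord_recl.
under eq_bigr do rewrite !mxE.
rewrite muleC.
have [_|] := ltP (a 0 0) (b 0 0); last first.
  move=> ba; have -> : b 0 0 = a 0 0 by apply/le_anti; rewrite ba ab.
  by rewrite subrr mul0r mul0e.
rewrite -EFinD -EFinM; congr (_ * _)%:E; apply: eq_bigr => i _; congr (b 0 _ - a 0 _); exact: val_inj.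
Qed.

End lebesgue_mx.

Section frobenius.
Context {R : realType} {m n : nat}.
Implicit Types A B : 'M[R]_(m, n).

Definition mxdot A B : R := \sum_i \sum_j A i j * B i j.

(* The Euclidean norm; the library norm `|A| on matrices is the max norm. *)
Definition frob A : R := Num.sqrt (mxdot A A).

Let sqE A : mxdot A A = \sum_i \sum_j A i j ^+ 2.
Proof. by apply: eq_bigr => i _; apply: eq_bigr => j _; rewrite expr2. Qed.

Let mxdot_ge0 A : 0 <= mxdot A A.
Proof. by rewrite sqE; do 2!apply: sumr_ge0 => ? _; exact: sqr_ge0. Qed.

Let frob_sqr A : frob A ^+ 2 = mxdot A A.
Proof. by rewrite /frob sqr_sqrtr. Qed.

Lemma frob_ge0 A : 0 <= frob A. Proof. exact: sqrtr_ge0. Qed.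

Lemma frobN A : frob (- A) = frob A.
Proof.
by congr Num.sqrt; do 2!apply: eq_bigr => ? _; rewrite !mxE mulrNN.
Qed.

Lemma frob0 : frob (0 : 'M[R]_(m, n)) = 0.
Proof.
by rewrite /frob /mxdot big1 ?sqrtr0// => i _; rewrite big1// => j _; rewrite mxE mul0r.
Qed.

Lemma frob_eq0 A : frob A = 0 -> A = 0.
Proof.
move=> /(congr1 (fun x => x ^+ 2)); rewrite frob_sqr expr0n/= sqE => /eqP.
rewrite psumr_eq0 => [/allP A0|i _]; last by apply: sumr_ge0 => j _; exact: sqr_ge0.
apply/matrixP => i j; rewrite mxE.
have /= := A0 i (mem_index_enum i).
rewrite psumr_eq0 => [/allP /(_ j (mem_index_enum j))/=|k _]; last exact: sqr_ge0.
by rewrite sqrf_eq0 => /eqP.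
Qed.

Let mxdot_lin (a b : R) A B :
  mxdot (a *: A + b *: B) (a *: A + b *: B) =
  a ^+ 2 * mxdot A A + 2 * (a * b) * mxdot A B + b ^+ 2 * mxdot B B.
Proof.
rewrite /mxdot !mulr_sumr -!big_split/=; apply: eq_bigr => i _.
rewrite !mulr_sumr -!big_split/=; apply: eq_bigr => j _.
by rewrite !mxE; ring.
Qed.

Let mxdot_le A B : mxdot A B <= frob A * frob B.
Proof.
have [B0|B0] := eqVneq (frob B) 0.
  rewrite B0 mulr0 (frob_eq0 B0) /mxdot big1// => i _.
  by rewrite big1// => j _; rewrite mxE mulr0.
have [A0|A0] := eqVneq (frob A) 0.
  rewrite A0 mul0r (frob_eq0 A0) /mxdot big1// => i _.
  by rewrite big1// => j _; rewrite mxE mul0r.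
have := mxdot_ge0 (frob B *: A + (- frob A) *: B).
rewrite mxdot_lin -!frob_sqr => h.
have ab : 0 < frob A * frob B by rewrite mulr_gt0// lt0r frob_ge0 andbT.
rewrite -(ler_pM2l ab); nra.
Qed.

Lemma ler_frobD A B : frob (A + B) <= frob A + frob B.
Proof.
rewrite -(@ler_pXn2r _ 2)// ?nnegrE ?addr_ge0 ?frob_ge0//.
rewrite frob_sqr; have := mxdot_lin 1 1 A B; rewrite !scale1r => ->.
rewrite -!frob_sqr; have := mxdot_le A B; nra.
Qed.

Lemma measurable_frob : measurable_fun setT (frob : 'M[R]_(m, n) -> R).
Proof.
rewrite (_ : frob = Num.sqrt \o (fun A => mxdot A A))//.
apply: measurableT_comp.
  by apply: continuous_measurable_fun; exact: sqrt_continuous.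
apply: measurable_sum => i; apply: measurable_sum => j.
by apply: measurable_funM; exact: measurable_coord.
Qed.

End frobenius.

Section domains.
Context {R : realType} {d : nat}.
Implicit Types (V : seq 'rV[R]_d).

Definition conv_hull V : set 'rV[R]_d :=
  [set x | exists w : 'I_(size V) -> R,
    [/\ forall i, 0 <= w i, \sum_i w i = 1 & x = \sum_i w i *: V`_i]].

Record polygonal_domain := PolygonalDomain {
  dom :> set 'rV[R]_d;
  dom_open : open dom;
  dom_nonempty : dom !=set0;
  dom_connected : connected dom;
  dom_bounded : bounded_set dom;
  dom_polytopal : exists P : seq (seq 'rV[R]_d),
    dom = interior (\bigcup_(V in [set` P]) conv_hull V) }.

End domains.
Arguments polygonal_domain : clear implicits.
Arguments dom_open {R d} _.

Section lebesgue_spaces.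
Context {R : realType} {d : nat} (O : polygonal_domain R d).

(* Functions on O are represented by functions on the whole space, considered
   up to null sets of this measure, which does not charge the complement. *)
Definition lebO : {measure set 'rV[R]_d -> \bar R} :=
  mrestr (lebesgue_rV d) (open_measurable_mx (dom_open O)).

Definition in_Lp m n (r : \bar R) (f : 'rV[R]_d -> 'M[R]_(m, n)) : Prop :=
  measurable_fun setT f /\ finite_norm lebO r (frob \o f).

Definition normLp (r : \bar R) (f : 'rV[R]_d -> R) : R :=
  fine ('N[lebO]_r[EFin \o f]).

Definition pairing (f g : 'rV[R]_d -> R) : R := \int[lebO]_x (f x * g x).

Definition pairing_mx m n (f g : 'rV[R]_d -> 'M[R]_(m, n)) : R :=
  \int[lebO]_x mxdot (f x) (g x).

Record L2fun := MkL2fun {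
  L2val :> 'rV[R]_d -> 'rV[R]_d;
  L2valP : `[< in_Lp 2%:E L2val >] }.
HB.instance Definition _ := [isSub for L2val].
HB.instance Definition _ := [Choice of L2fun by <:].

Lemma in_L2_0 : `[< in_Lp 2%:E (cst (0 : 'rV[R]_d)) >].
Proof.
apply/asboolP; split; first exact: measurable_cst.
rewrite /finite_norm (_ : _ \o _ = cst 0%E) ?Lnorm0//.
by apply/funext => x /=; rewrite frob0.
Qed.

Definition L2fun0 : L2fun := MkL2fun in_L2_0.

Definition L2eqv (f g : L2fun) : bool := `[< \forall x \ae lebO, f x = g x >].

Let L2eqv_refl : reflexive L2eqv.
Proof. by move=> f; apply/asboolP; exact: nearW. Qed.

Let L2eqv_sym : symmetric L2eqv.
Proof.
move=> f g; apply/idP/idP => /asboolP fg; apply/asboolP;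
  by apply: filterS fg => x ->.
Qed.

Let L2eqv_trans : transitive L2eqv.
Proof.
move=> g f h /asboolP fg /asboolP gh; apply/asboolP.
by apply: filterS2 fg gh => x -> ->.
Qed.

Canonical L2eqv_equiv := EquivRel L2eqv L2eqv_refl L2eqv_sym L2eqv_trans.

Local Open Scope quotient_scope.

(* The space of square-integrable vector fields, modulo a.e. equality. *)
Definition L2 : Type := {eq_quot L2eqv}.
HB.instance Definition _ := Choice.on L2.
HB.instance Definition _ := EqQuotient.on L2.
HB.instance Definition _ := isPointed.Build L2 (\pi_L2 L2fun0).

Definition L2rep (u : L2) : 'rV[R]_d -> 'rV[R]_d := repr u.

(* The class of f, or the zero class when f is not square-integrable. *)
Definition toL2 (f : 'rV[R]_d -> 'rV[R]_d) : L2 := \pi_L2 (insubd L2fun0 f).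

Definition L2dist (u v : L2) : R :=
  normLp 2%:E (fun x => frob (L2rep u x - L2rep v x)).

Let mfield (f g : L2fun) : measurable_fun setT (fun x => frob (f x - g x)).
Proof.
have /asboolP[mf _] := L2valP f; have /asboolP[mg _] := L2valP g.
apply: (measurableT_comp measurable_frob).
apply: measurable_fun_mx => i j; under eq_fun do rewrite !mxE.
apply: measurable_funB; exact: measurableT_comp (measurable_coord i j) _.
Qed.

Let le_norm2 (f g : 'rV[R]_d -> R) :
  measurable_fun setT f -> measurable_fun setT g -> (forall x, 0 <= f x <= g x) ->
  ('N[lebO]_2%:E[EFin \o f] <= 'N[lebO]_2%:E[EFin \o g])%E.
Proof.
move=> mf mg fg.
have m2 (h : 'rV[R]_d -> R) : measurable_fun setT h ->
    measurable_fun setT (fun x => (`|(h x)%:E| `^ 2)%E).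
  move=> mh; apply: (measurableT_comp (f := EFin)) => //.
  apply: (measurableT_comp (f := (fun y : R => y `^ 2))) => //.
  exact: measurableT_comp.
rewrite unlock; apply: gt0_ler_poweR.
- by rewrite invr_ge0.
- by rewrite in_itv/= leey andbT integral_ge0// => x _; rewrite poweR_ge0.
- by rewrite in_itv/= leey andbT integral_ge0// => x _; rewrite poweR_ge0.
apply: (ge0_le_integral lebO measurableT _ (m2 _ mf) (m2 _ mg)).
  by move=> x _; rewrite poweR_ge0.
move=> x _ /=; have /andP[f0 fgx] := fg x.
by rewrite lee_fin ge0_ler_powR ?nnegrE ?normr_ge0// !ger0_norm// (le_trans f0).
Qed.

Let fin_field (f g : L2fun) :
  ('N[lebO]_2%:E[EFin \o (fun x => frob (f x - g x))] < +oo)%E.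
Proof.
have /asboolP[mf ff] := L2valP f; have /asboolP[mg fg] := L2valP g.
apply: (@le_lt_trans _ _ ('N[lebO]_2%:E[EFin \o (frob \o f)] +
   'N[lebO]_2%:E[EFin \o (frob \o g)])%E); last by rewrite lte_add_pinfty.
have mfr (h : L2fun) : measurable_fun setT (frob \o h).
  by have /asboolP[mh _] := L2valP h; exact: measurableT_comp measurable_frob mh.
apply: le_trans (eminkowski lebO (mfr f) (mfr g) _); last by rewrite lee_fin ler1n.
apply: le_norm2 => [||x]; [exact: mfield| |]; last first.
  by rewrite frob_ge0/= -(frobN (g x)) ler_frobD.
by apply: measurable_funD; exact: mfr.
Qed.

Let L2dist_fin (u v : L2) : (L2dist u v)%:E =
  'N[lebO]_2%:E[EFin \o (fun x => frob (L2rep u x - L2rep v x))]%E.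
Proof.
by rewrite /L2dist /normLp fineK// ge0_fin_numE ?Lnorm_ge0//; exact: fin_field.
Qed.

Let L2distxx u : L2dist u u = 0.
Proof.
apply: EFin_inj; rewrite L2dist_fin (_ : _ \o _ = cst 0%E) ?Lnorm0//.
by apply/funext => x /=; rewrite subrr frob0.
Qed.

Let L2dist_pos u v : L2dist u v = 0 -> u = v.
Proof.
move=> uv; have := L2dist_fin u v; rewrite uv => /esym uv0.
have muv : measurable_fun setT
    (EFin \o (fun x => frob (L2rep u x - L2rep v x))).
  by apply/measurable_EFinP; exact: mfield.
have {}uv := Lnorm_eq0_eq0 muv (ltr0n R 2 : (0 < 2%:E)%E) uv0.
rewrite -[u]reprK -[v]reprK; apply/eqmodP => /=; apply/asboolP.
apply: filterS uv => x /(_ Logic.I) /= [] /frob_eq0 /eqP.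
by rewrite subr_eq0 => /eqP.
Qed.

Let L2dist_sym u v : L2dist u v = L2dist v u.
Proof.
congr (fine (Lnorm _ _ _)); apply/funext => x /=.
by rewrite -frobN opprB.
Qed.

Let L2dist_triangle v u w : L2dist u w <= L2dist u v + L2dist v w.
Proof.
rewrite -lee_fin EFinD !L2dist_fin.
apply: le_trans (eminkowski lebO (mfield _ _) (mfield _ _) _); last by rewrite lee_fin ler1n.
apply: le_norm2 => [||x].
- exact: mfield.
- by apply: measurable_funD; exact: mfield.
- rewrite frob_ge0/=.
  have <- : L2rep u x - L2rep v x + (L2rep v x - L2rep w x) = L2rep u x - L2rep w x.
    by rewrite addrA subrK.
  exact: ler_frobD.
Qed.

HB.instance Definition _ :=
  isMetric.Build R L2 L2distxx L2dist_pos L2dist_sym L2dist_triangle.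

HB.instance Definition _ :=
  @isMeasurable.Build (sigma_display (@open L2)) L2 <<s @open L2 >>
    (@sigma_algebra0 _ setT open) (@sigma_algebraC _ open)
    (@sigma_algebra_bigcup _ setT open).

End lebesgue_spaces.

Section sobolev_spaces.
Context {R : realType} {d : nat} (O : polygonal_domain R d).
Implicit Types (f h phi : 'rV[R]_d -> R) (z : 'rV[R]_d -> 'rV[R]_d).

Definition partial (i : 'I_d) f : 'rV[R]_d -> R :=
  fun x => 'D_(delta_mx 0 i : 'rV[R]_d) f x.

(* Partial derivatives of all orders exist and are Frechet differentiable. *)
Definition smooth_on (A : set 'rV[R]_d) f : Prop :=
  forall s : seq 'I_d, forall x, A x -> differentiable (foldr partial f s) x.

Definition test_fun phi : Prop :=
  let supp := closure [set x | phi x != 0] in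
  [/\ smooth_on setT phi, compact supp & supp `<=` O].

Definition loc_integrable f : Prop :=
  measurable_fun setT f /\
  forall K : set 'rV[R]_d, compact K -> K `<=` O ->
    (lebO O).-integrable K (EFin \o f).

Definition is_wpartial (i : 'I_d) f h : Prop :=
  [/\ loc_integrable f, loc_integrable h &
      forall phi, test_fun phi ->
        pairing O f (partial i phi) = - pairing O h phi].

Definition wpartial (i : 'I_d) f : 'rV[R]_d -> R :=
  xget (cst 0) [set h | is_wpartial i f h].

Fixpoint sobolev (k : nat) (r : \bar R) f : Prop :=
  f \in Lfun (lebO O) r /\
  if k is k'.+1 then
    forall i, is_wpartial i f (wpartial i f) /\ sobolev k' r (wpartial i f)
  else True.

Definition coordf z (i : 'I_d) : 'rV[R]_d -> R := fun x => z x 0 i.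

Definition vsobolev (k : nat) (r : \bar R) z : Prop :=
  forall i, sobolev k r (coordf z i).

Definition wderiv (s : seq 'I_d) z : 'rV[R]_d -> 'rV[R]_d :=
  fun x => \row_i foldr wpartial (coordf z i) s x.

Definition norm_sobolev (k : nat) (r : \bar R) z : R :=
  \sum_(j < k.+1) \sum_(s : j.-tuple 'I_d) normLp O r (frob \o wderiv s z).

(* Entry (j, i) is the weak derivative of the i-th component in direction j. *)
Definition wgrad z : 'rV[R]_d -> 'M[R]_d :=
  fun x => \matrix_(j, i) wpartial j (coordf z i) x.

Definition wsymgrad z : 'rV[R]_d -> 'M[R]_d :=
  fun x => 2^-1 *: (wgrad z x + (wgrad z x)^T).

Definition smooth_solenoidal z : Prop :=
  (forall i, smooth_on O (coordf z i)) /\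
  forall x, dom O x -> \sum_i partial i (coordf z i) x = 0.

Definition sobolev_div (k : nat) z : Prop :=
  vsobolev k +oo%E z /\
  forall e : R, 0 < e -> exists h : 'rV[R]_d -> 'rV[R]_d,
    [/\ vsobolev k +oo%E h, smooth_solenoidal h &
        norm_sobolev k +oo%E (fun x => h x - z x) < e].

End sobolev_spaces.

Section gradient_discretisation.
Context {R : realType} {d : nat} (O : polygonal_domain R d).

Definition linear_ae (V W : lmodType R) (f : V -> 'rV[R]_d -> W) : Prop :=
  forall (a : R) (u v : V),
    \forall x \ae lebO O, f (a *: u + v) x = a *: f u x + f v x.

Definition is_norm_on (V : lmodType R) (A : set V) (N : V -> R) : Prop :=
  [/\ forall u v, A u -> A v -> N (u + v) <= N u + N v,
      forall a u, A u -> N (a *: u) = `|a| * N u &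
      forall u, A u -> N u = 0 -> u = 0].

Definition conj_exp (p : R) : R := p / (p - 1).

Record gd_data (X Y : vectType R) := GDData {
  gd_grad : X -> 'rV[R]_d -> 'M[R]_d;
  gd_eps : X -> 'rV[R]_d -> 'M[R]_d;
  gd_div : X -> 'rV[R]_d -> R;
  gd_Pi : X -> 'rV[R]_d -> 'rV[R]_d;
  gd_chi : Y -> 'rV[R]_d -> R }.

Context {X Y : vectType R} (D : gd_data X Y) (p : R).
Let p' : R := conj_exp p.

Definition norm_eps (r : R) (v : X) : R := normLp O r%:E (frob \o gd_eps D v).

Definition norm_chi (q : Y) : R := normLp O (Num.min p p')%:E (gd_chi D q).

Definition Y0 : set Y := [set q | \int[lebO O]_x gd_chi D q x = 0].

Definition E0 : set X :=
  [set v | forall q, Y0 q -> pairing O (gd_chi D q) (gd_div D v) = 0].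

Record is_gd : Prop := IsGD {
  gd_grad_lin : linear_ae (gd_grad D);
  gd_eps_lin : linear_ae (gd_eps D);
  gd_div_lin : linear_ae (gd_div D : X -> 'rV[R]_d -> R^o);
  gd_Pi_lin : linear_ae (gd_Pi D);
  gd_chi_lin : linear_ae (gd_chi D : Y -> 'rV[R]_d -> R^o);
  gd_Lp : forall r, r = p \/ r = p' -> forall v,
    [/\ in_Lp O r%:E (gd_grad D v), in_Lp O r%:E (gd_eps D v),
        in_Lp O r%:E (gd_Pi D v) & gd_div D v \in Lfun (lebO O) r%:E];
  gd_Pi_L2 : forall v, in_Lp O 2%:E (gd_Pi D v);
  gd_chi_Lp : forall q, gd_chi D q \in Lfun (lebO O) (Num.min p p')%:E;
  gd_eps_norm : is_norm_on setT (norm_eps p);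
  gd_chi_norm : is_norm_on Y0 norm_chi;
  gd_Pi_inj : forall u v, E0 u -> E0 v ->
    (\forall x \ae lebO O, gd_Pi D u x = gd_Pi D v x) -> u = v }.

(* K is defined on representatives rather than on L2, since the constant CSob
   below evaluates it on W^{1,r}, which need not be contained in L2. *)
Definition is_K (u : 'rV[R]_d -> 'rV[R]_d) (k : X) : Prop :=
  E0 k /\ forall xi, E0 xi ->
    pairing_mx O (fun x => u x - gd_Pi D k x) (gd_Pi D xi) = 0.

Definition gd_K (u : 'rV[R]_d -> 'rV[R]_d) : X := xget 0 (is_K u).

Definition gd_C (r : R) : \bar R :=
  ereal_sup [set ((normLp O r%:E (frob \o gd_Pi D v) +
                   normLp O r%:E (gd_div D v) +
                   normLp O r%:E (frob \o gd_grad D v)) / norm_eps r v)%:E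
            | v in [set v | v != 0]].

Definition gd_CSob (r : R) : \bar R :=
  ereal_sup [set (norm_eps r (gd_K z) / norm_sobolev O 1 r%:E z)%:E
            | z in [set z | vsobolev O 1 r%:E z /\
                            ~ \forall x \ae lebO O, z x = 0]].

Definition gd_beta : \bar R :=
  ereal_inf [set ereal_sup
      [set (pairing O (gd_chi D q) (gd_div D v) /
            (norm_chi q * (norm_eps p v + norm_eps p' v)))%:E
      | v in [set v | v != 0]]
    | q in [set q | Y0 q /\ q != 0]].

Definition gd_stable (Gamma : R) : Prop :=
  [/\ 1 <= Gamma,
      (gd_C p + gd_C p' <= Gamma%:E)%E,
      (Gamma^-1%:E <= gd_beta)%E &
      (gd_CSob p + gd_CSob p' <= Gamma%:E)%E].

End gradient_discretisation.
Arguments gd_data {R} d X Y.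

Section wiener.
Context {dsp : measure_display} {Omega : measurableType dsp} {R : realType}.
Variable P : probability Omega R.

(* Time is the half line [0, +oo[; values at negative times are irrelevant. *)
Record usual_filtration (F : R -> set (set Omega)) : Prop := UsualFiltration {
  filt_sigma : forall t, 0 <= t -> sigma_algebra setT (F t);
  filt_sub : forall t, 0 <= t -> F t `<=` measurable;
  filt_mono : forall s t, 0 <= s -> s <= t -> F s `<=` F t;
  filt_right : forall t, 0 <= t ->
    \bigcap_(s in [set s | t < s]) F s `<=` F t;
  filt_complete : forall N, P.-negligible N -> F 0 N }.

Record wiener (F : R -> set (set Omega)) (W : R -> Omega -> R) : Prop := Wiener {
  wiener_adapted : forall t, 0 <= t ->
    preimage_set_system setT (W t) measurable `<=` F t;
  wiener0 : \forall w \ae P, W 0 w = 0;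
  wiener_indep : forall s t, 0 <= s -> s < t ->
    forall A (B : set R), F s A -> measurable B ->
      P (A `&` [set w | B (W t w - W s w)]) =
      (P A * P [set w | B (W t w - W s w)%R])%E;
  wiener_gauss : forall s t, 0 <= s -> s < t ->
    forall B : set R, measurable B ->
      P [set w | B (W t w - W s w)] = normal_prob 0 (Num.sqrt (t - s)) B;
  wiener_continuous : \forall w \ae P,
    {within `[0, +oo[, continuous (fun t => W t w)} }.

End wiener.

Section algorithm.
Context {R : realType} {d : nat} (O : polygonal_domain R d) {X Y : vectType R}.
Variables (D : gd_data d X Y) (p kappa tau : R) (g sigma : 'rV[R]_d -> 'rV[R]_d).

Definition stress (A : 'M[R]_d) : 'M[R]_d :=
  ((kappa + frob A ^+ 2) `^ ((p - 2) / 2)) *: A.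

Definition noise_form (v xi : X) : R :=
  2^-1 * pairing_mx O (fun x => sigma x *m gd_grad D v x) (gd_Pi D xi) -
  2^-1 * pairing_mx O (gd_Pi D v) (fun x => sigma x *m gd_grad D xi x).

Definition init_step (vin : L2 O) (v : X) (q : Y) : Prop :=
  [/\ Y0 O D q,
      forall xi, pairing_mx O (gd_Pi D v) (gd_Pi D xi) +
                 pairing O (gd_chi D q) (gd_div D xi) =
                 pairing_mx O (L2rep vin) (gd_Pi D xi) &
      forall q', Y0 O D q' -> pairing O (gd_div D v) (gd_chi D q') = 0].

Definition mid (v w : X) : X := 2^-1 *: (w + v).

Definition time_step (dW : R) (v : X) (q : Y) (v1 : X) (q1 : Y) : Prop :=
  let vh := mid v v1 in
  [/\ Y0 O D q1,
      forall xi : X,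
        pairing_mx O (fun x => gd_Pi D v1 x - gd_Pi D v x) (gd_Pi D xi) +
        tau * pairing_mx O (fun x => stress (gd_eps D vh x + wsymgrad O g x))
                       (gd_eps D xi) -
        pairing O (fun x => gd_chi D q1 x - gd_chi D q x) (gd_div D xi) =
        (noise_form vh xi +
         pairing_mx O (fun x => sigma x *m wgrad O g x) (gd_Pi D xi)) * dW &
      forall q', Y0 O D q' -> pairing O (gd_div D vh) (gd_chi D q') = 0].

Context {dsp : measure_display} {Omega : measurableType dsp}.
Variables (P : probability Omega R) (W : R -> Omega -> R).

(* Borel measurability in a finite-dimensional space, tested on functionals. *)
Definition random_vector (V : vectType R) (v : Omega -> V) : Prop :=
  forall l : {linear V -> R^o}, measurable_fun setT (fun w => l (v w) : R).

(* S n and Q n are the velocity and the pressure at time n tau. *)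
Record solution (vin : L2 O) (S : nat -> Omega -> X) (Q : nat -> Omega -> Y)
    : Prop := Solution {
  sol_measurable : forall n, random_vector (S n);
  sol_init : forall w, init_step vin (S 0%N w) (Q 0%N w);
  sol_step : forall n, \forall w \ae P,
    time_step (W (n.+1%:R * tau) w - W (n%:R * tau) w)
      (S n w) (Q n w) (S n.+1 w) (Q n.+1 w) }.

Definition S_half (S : nat -> Omega -> X) (n : nat) (w : Omega) : X :=
  mid (S n w) (S n.+1 w).

(* The averaged laws, as a set function; a probability measure on Borel sets
   when the S n are random vectors. *)
Definition mu_half (S : nat -> Omega -> X) (N : nat) (A : set (L2 O)) : \bar R :=
  ((N%:R^-1)%:E *
   \sum_(n < N) P [set w | A (toL2 O (gd_Pi D (S_half S n w)))])%E.

End algorithm.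

(* Main.v *)
Require Import Defs.
From HB Require Import structures.
From mathcomp Require Import all_boot all_order all_algebra.
From mathcomp Require Import all_classical all_reals all_analysis.
From mathcomp Require Import ring lra measurable_realfun.

Set Implicit Arguments.
Unset Strict Implicit.
Unset Printing Implicit Defensive.

Import Order.TTheory GRing.Theory Num.Theory.
Import numFieldNormedType.Exports VectorInternalTheory.

Local Open Scope classical_set_scope.
Local Open Scope ring_scope.

(** Since the time step tau is fixed, a pathwise energy estimate is enough.
Testing one step of the scheme with the midpoint velocity makes the pressure
and the skew-symmetric noise form vanish and turns the increment into a
difference of kinetic energies.  The stress is coercive, even shifted by the
bounded field eps g, so it controls the p-th power of the norm of the midpoint;
the one term left is linear in the midpoint and in the Wiener increment, and
Young's inequality trades it for a fraction of the dissipation and a multiple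
of |Delta W|^p' ([time_step_energy]).  The energies telescope over n < N, and
all increments over a step have the same Gaussian p'-th moment.  Hence the
average over n < N of the probabilities that the midpoint has norm larger than
r is O(1/r), uniformly in N ([average_tail]).

The discrete velocities live in the finite-dimensional space X, where all norms
are equivalent ([seminorm_le_coord], [norm_ge_coord]).  The averaged laws of
their coordinates are therefore tight on row vectors, and Prokhorov's theorem
([prokhorov_rV]) gives a subsequence with a weak limit.  The map from
coordinates to square-integrable fields is continuous
([continuous_reconstruct]), so taking image measures gives the theorem.

Prokhorov's theorem is proved by Skorokhod's representation.  A point is coded
by its answers to countably many questions: whether its i-th coordinate is less
than the rational q, for all i and q.  The first m answers cut space into
finitely many cells, and those that meet a given ball are small once m is large
([code_half_space_separates]).
A diagonal extraction makes the masses of all cells converge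
([diagonal_subsequence]).  The limit masses split consistently along the binary
tree of words, so they are the lengths of nested subintervals of the unit
interval ([unif01_draw]): a uniform number draws an infinite word.  Points
chosen in the cells of its prefixes form, by tightness, a Cauchy sequence for
almost every number, and the law of the limit is the weak limit. *)

(** * Diagonal extraction *)

(** An ultrafilter finer than the filter of cofinal sets has a limit along every
bounded coordinate at once, so each finite set of coordinates is close to the
limit for arbitrarily large indices; these indices are then collected
greedily. *)
Lemma diagonal_subsequence (R : realType) (I : countType) (a : nat -> I -> R) :
  (forall k i, 0 <= a k i <= 1) ->
  exists (phi : nat -> nat) (p : I -> R),
    {homo phi : i j / (i < j)%N} /\
    forall i, a (phi k) i @[k --> \oo] --> p i.
Proof.
move=> a01.
have [U [uU ooU]] := ultraFilterLemma eventually_filter.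
have PU : ProperFilter U := @ultra_proper _ _ uU.
have /choice[p pP] (i : I) : exists x : R, a^~ i @ U --> x.
  have /(_ (a^~ i @ U)) := @segment_compact R 0 1.
  have h01 : (a^~ i @ U) `[0, 1]%classic.
    by apply: (@filterE _ U) => k; rewrite /= in_itv /= a01.
  move=> /(_ _ h01)[x [_ xcl]]; exists x => A Ax /=.
  have [//|UA] := in_ultra_setVsetC (a^~ i @^-1` A) uU.
  by have [y [/= nAy Ay]] := xcl (~` A) A UA Ax.
pose good (m k : nat) := forall j, (j < m)%N ->
  forall i, unpickle j = Some i -> `|p i - a k i| < m.+1%:R^-1.
have Ugood m : U (good m).
  suff : forall l, U (fun k => forall j, (j < l)%N ->
      forall i, unpickle j = Some i -> `|p i - a k i| < m.+1%:R^-1) by exact.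
  elim=> [|l IH]; first exact: filterE.
  case il : (unpickle l : option I) => [i|]; last first.
    apply: filterS IH => k IH j; rewrite ltnS leq_eqVlt => /predU1P[->|]; last exact: IH.
    by rewrite il.
  have /cvgrPdist_lt /(_ m.+1%:R^-1) hi := pP i.
  have hm : (0 : R) < m.+1%:R^-1 by rewrite invr_gt0.
  apply: filterS2 IH (hi hm) => k IH hk j.
  rewrite ltnS leq_eqVlt => /predU1P[->|]; last exact: IH.
  by move=> i'; rewrite il => -[<-].
have ex m K : exists k, (K < k)%N /\ good m k.
  have UK : U (fun k => (K < k)%N) by apply: ooU; exact: nbhs_infty_gt.
  by have [k [Kk gk]] := filter_ex (filterI UK (Ugood m)); exists k.
pose next m K := projT1 (cid (ex m K)).
have nextP m K : (K < next m K)%N /\ good m (next m K).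
  by rewrite /next; case: cid.
pose phi := fix phi m := if m is m'.+1 then next m (phi m') else next 0%N 0%N.
exists phi, p; split=> [|i].
- apply: (@homo_ltn _ phi (fun i j => (i < j)%N)) => [y x z|k].
    exact: ltn_trans.
  by have [] := nextP k.+1 (phi k).
have gphi k : good k (phi k) by case: k => [|k]; [exact: (nextP 0%N 0%N).2|exact: (nextP k.+1 (phi k)).2].
apply/cvgrPdist_lt => e e0.
near=> k.
apply: (@lt_trans _ _ k.+1%:R^-1).
  apply: (gphi k (pickle i)); last by rewrite pickleK.
  by near: k; exact: nbhs_infty_gt.
near: k; exact: near_infty_natSinv_lt (PosNum e0).
Unshelve. all: by end_near. Qed.

(** * Binary words *)

Section words.
Context {d : measure_display} {T : measurableType d} {R : realType}.
Variables (m : nat) (h : T -> seq bool).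
Hypothesis size_h : forall x, size (h x) = m.
Hypothesis measurable_h : forall w, measurable [set x | h x = w].

Let word_sumE (c : seq bool -> R) x :
  c (h x) = \sum_(w : m.-tuple bool) c w * \1_[set y | h y = w] x.
Proof.
rewrite (bigD1 (Tuple (introT eqP (size_h x))))//= indicE mem_set// mulr1.
rewrite big1 ?addr0// => w /eqP wx; rewrite indicE memNset ?mulr0//= => hw.
by apply: wx; exact: val_inj.
Qed.

Lemma measurable_fun_word (c : seq bool -> R) :
  measurable_fun setT (fun x => c (h x)).
Proof.
under eq_fun do rewrite word_sumE.
apply: measurable_sum => w; apply: measurable_funM; first exact: measurable_cst.
exact: measurable_indic.
Qed.

(** A function of a random word of fixed length takes finitely many values; this
is how integrals are compared before and after the passage to the limit. *)
Lemma integral_word (mu : probability T R) (c : seq bool -> R) :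
  (\int[mu]_x (c (h x))%:E =
   (\sum_(w : m.-tuple bool) c w * fine (mu [set x | h x = w]))%:E)%E.
Proof.
under eq_integral.
  move=> x _; rewrite word_sumE -sumEFin.
  under eq_bigr do rewrite EFinM.
  over.
rewrite integral_sum//; last first.
  by move=> w; apply: integrableZl => //; exact: integrable_indic.
rewrite -sumEFin; apply: eq_bigr => w _.
rewrite integralZl//; last exact: integrable_indic.
by rewrite integral_indic// setIT EFinM fineK// fin_num_measure.
Qed.

Lemma measurable_word_set (Q : set (seq bool)) : measurable [set x | Q (h x)].
Proof.
have -> : [set x | Q (h x)] = setT `&` (fun x => \1_Q (h x) : R) @^-1` [set 1].
  rewrite setTI; apply/seteqP; split => x /=; rewrite indicE => Qx.
    by rewrite mem_set.
  by move: Qx; case: (boolP (_ \in _)) => [/set_mem//|_] /eqP; rewrite eq_sym oner_eq0.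
exact: measurable_fun_word.
Qed.

Lemma Rintegral_word_set (mu : probability T R) (Q : set (seq bool)) :
  \int[mu]_x \1_Q (h x) = fine (mu [set x | Q (h x)]).
Proof.
rewrite -[in RHS](setIT [set _ | _]) -integral_indic//; last exact: measurable_word_set.
Qed.

End words.

Section coding.
Context {T : Type} (U : nat -> set T).

(** Answers to the first m questions, the latest one at the head, so that
extending a word by one answer is a cons. *)
Fixpoint code (m : nat) (x : T) : seq bool :=
  if m is m'.+1 then `[< U m' x >] :: code m' x else [::].

Lemma size_code m x : size (code m x) = m.
Proof. by elim: m => //= m ->. Qed.

Lemma code_le m m' x y : (m <= m')%N -> code m' x = code m' y ->
  code m x = code m y.
Proof.
move=> mm'; rewrite -(subnK mm'); elim: (m' - m)%N => // k IH.
by rewrite addSn => -[_]; exact: IH.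
Qed.

Lemma codeP m x y : code m x = code m y -> forall k, (k < m)%N -> U k x <-> U k y.
Proof.
elim: m => // m IH [Um /IH xy] k; rewrite ltnS leq_eqVlt => /predU1P[->|]; last exact: xy.
by split=> ?; apply/asboolP; [rewrite -Um|rewrite Um]; exact/asboolP.
Qed.

End coding.

Lemma measurable_code d (T : measurableType d) (U : nat -> set T) :
  (forall k, measurable (U k)) ->
  forall m w, measurable [set x | code U m x = w].
Proof.
move=> mU; elim=> [|m IH] [|b w] /=.
- by rewrite (_ : [set _ | _] = setT)//; apply/seteqP; split.
- by rewrite (_ : [set _ | _] = set0)//; apply/seteqP; split.
- by rewrite (_ : [set _ | _] = set0)//; apply/seteqP; split.
rewrite (_ : [set _ | _] = [set x | code U m x = w] `&` (if b then U m else ~` U m)).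
  by apply: measurableI => //; case: b => //; exact: measurableC.
apply/seteqP; split => x /=.
  by move=> [<- <-]; split=> //; case: asboolP.
by move=> [->]; case: b => Ux; congr (_ :: _); [exact/asboolP|exact/asboolPn].
Qed.

Section binary_tree.
Context {R : realType} (p : seq bool -> R).
Hypothesis p_nil : p [::] = 1.
Hypothesis p_ge0 : forall w, 0 <= p w.
Hypothesis p_split : forall w, p w = p (false :: w) + p (true :: w).

(** The interval of a word w is [left_end w, left_end w + p w[; its left part
belongs to the child false :: w and its right part to true :: w. *)
Fixpoint left_end (w : seq bool) : R :=
  if w is b :: w' then left_end w' + (if b then p (false :: w') else 0) else 0.

(** Locates t by bisection: for t in the unit interval, the interval of
[draw m t] is the one among those of words of length m that contains t. *)
Fixpoint draw (m : nat) (t : R) : seq bool :=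
  if m is m'.+1
  then (left_end (draw m' t) + p (false :: draw m' t) <= t) :: draw m' t
  else [::].

Lemma size_draw m t : size (draw m t) = m.
Proof. by elim: m => //= m ->. Qed.

Lemma draw_itv m t : 0 <= t < 1 ->
  left_end (draw m t) <= t < left_end (draw m t) + p (draw m t).
Proof.
move=> t01; elim: m => [|m IH] /=; first by rewrite p_nil add0r.
have /andP[lt tr] := IH.
have e := p_split (draw m t).
by case: (leP (_ + p (false :: draw m t)) t) => h /=; apply/andP; split; lra.
Qed.

Lemma draw_uniq w t : left_end w <= t < left_end w + p w -> draw (size w) t = w.
Proof.
elim: w => //= b w IH ht.
have pe := p_split w.
have {}IH : draw (size w) t = w.
  apply: IH; have := p_ge0 (true :: w); have := p_ge0 (false :: w).
  by case: b ht => /= ht ? ?; lra.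
rewrite IH; congr (_ :: _).
by case: b ht => /= ht; [apply/idP; lra|apply/negbTE; rewrite -ltNge; lra].
Qed.

Lemma left_end01 w : 0 <= left_end w /\ left_end w + p w <= 1.
Proof.
elim: w => [|b w [IH1 IH2]] /=; first by rewrite p_nil add0r.
have := p_split w; have := p_ge0 (false :: w); have := p_ge0 (true :: w).
by case: b => ? ? ?; split; lra.
Qed.

Lemma measurable_draw m w : measurable [set t : R | draw m t = w].
Proof.
elim: m w => [|m IH] [|b w] /=.
- by rewrite (_ : [set _ | _] = setT)//; apply/seteqP; split.
- by rewrite (_ : [set _ | _] = set0)//; apply/seteqP; split.
- by rewrite (_ : [set _ | _] = set0)//; apply/seteqP; split.
pose a := left_end w + p (false :: w).
rewrite (_ : [set _ | _] = [set t | draw m t = w] `&`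
    (if b then `[a, +oo[%classic else `]-oo, a[%classic)).
  by apply: measurableI => //; case: b.
apply/seteqP; split => t /=.
  move=> [be e]; rewrite e in be; split=> //; rewrite -be /a.
  by case: leP => h; rewrite /= in_itv/= ?andbT.
move=> [->]; case: b; rewrite /= in_itv/= ?andbT /a => h; congr (_ :: _) => //.
by apply/negbTE; rewrite -ltNge.
Qed.

End binary_tree.

Section unit_interval.
Context {R : realType}.

(** The uniform law on the unit interval, half-open like the intervals of words
so that the words of each length partition it exactly. *)
Definition unif01 (A : set R) : \bar R :=
  lebesgue_measure (A `&` `[0, 1[%classic).

Let unif01_0 : unif01 set0 = 0%E.
Proof. by rewrite /unif01 set0I measure0. Qed.

Let unif01_ge0 A : (0 <= unif01 A)%E.
Proof. exact: measure_ge0. Qed.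

Let unif01_sigma_additive : semi_sigma_additive unif01.
Proof.
exact: (@measure_semi_sigma_additive _ _ _
  (mrestr (@lebesgue_measure R) (measurable_itv `[0, 1[))).
Qed.

HB.instance Definition _ := isMeasure.Build _ _ _ unif01
  unif01_0 unif01_ge0 unif01_sigma_additive.

Let unif01_setT : unif01 setT = 1%E.
Proof.
rewrite /unif01 setTI lebesgue_measure_itv/= lte_fin ltr01.
by rewrite oppr0 adde0.
Qed.

HB.instance Definition _ :=
  Measure_isProbability.Build _ _ _ unif01 unif01_setT.

End unit_interval.

(** Masses that split consistently along the binary tree are realised by a
random infinite word. *)
Lemma unif01_draw (R : realType) (p : seq bool -> R) :
  p [::] = 1 -> (forall w, 0 <= p w) ->
  (forall w, p w = p (false :: w) + p (true :: w)) ->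
  forall w, unif01 [set t | draw p (size w) t = w] = (p w)%:E.
Proof.
move=> p1 p0 pD w; rewrite /unif01.
have [l0 l1] := left_end01 p1 p0 pD w.
rewrite (_ : _ `&` _ = `[left_end p w, left_end p w + p w[%classic); last first.
  apply/seteqP; split => t /=; rewrite !in_itv/=.
    by move=> [e t01]; have := draw_itv p1 pD (size w) t01; rewrite e.
  by move=> ht; split; [exact: draw_uniq|lra].
rewrite lebesgue_measure_itv/= lte_fin.
case: ltP => h; first by rewrite -EFinB; congr EFin; ring.
by congr EFin; apply/eqP; rewrite eq_le p0 /= -(lerD2l (left_end p w)) addr0.
Qed.

(** * Row vectors and their codes *)

Section row_vectors.
Context {R : realType} {n : nat}.
Implicit Types x y : 'rV[R]_n.

Lemma ler_coord_norm x i : `|x 0 i| <= `|x|.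
Proof.
rewrite [leRHS]/Num.norm/= mx_normrE.
exact: (le_bigmax _ (fun ij : 'I_1 * 'I_n => `|x ij.1 ij.2|) (0, i)).
Qed.

Lemma rV_norm_lt x (e : R) : 0 < e -> (forall i, `|x 0 i| < e) -> `|x| < e.
Proof.
move=> e0 xe; rewrite [ltLHS]/Num.norm/= mx_normrE.
by apply/bigmax_ltP; split=> // -[i j] _ /=; rewrite ord1.
Qed.

Lemma closed_norm_le (r : R) : closed [set x : 'rV[R]_n | `|x| <= r].
Proof.
apply: (@closed_comp _ _ (fun x : 'rV[R]_n => `|x|) [set y : R | y <= r]).
  by move=> x _; exact: norm_continuous.
exact: closed_le.
Qed.

Lemma compact_norm_le (r : R) : compact [set x : 'rV[R]_n | `|x| <= r].
Proof.
apply: bounded_closed_compact; last exact: closed_norm_le.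
exists r; split; first exact: num_real.
by move=> M rM x /= xr; exact: le_trans (ltW rM).
Qed.

Lemma measurable_norm_gt (r : R) : measurable [set x : 'rV[R]_n | r < `|x|].
Proof.
rewrite (_ : [set _ | _] = ~` [set x : 'rV[R]_n | `|x| <= r]).
  apply: open_measurable_mx; rewrite openC; exact: closed_norm_le.
by apply/seteqP; split => x /=; rewrite ltNge => /negP.
Qed.

(** Heine's theorem on a ball, with the second point allowed outside of it. *)
Lemma continuous_uniform_le (f : 'rV[R]_n -> R) (r e : R) :
  continuous f -> 0 < e ->
  exists2 dl : R, 0 < dl & forall x y, `|x| <= r -> `|x - y| < dl -> `|f x - f y| < e.
Proof.
move=> cf e0.
have := (compact_near_coveringP _).1 (@compact_norm_le r).
move=> /(_ R (0^'+) (fun dl x => forall y, `|x - y| < dl -> `|f x - f y| < e)).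
have H : forall x, [set x | `|x| <= r] x ->
    \forall x' \near x & dl \near 0^'+, forall y, `|x' - y| < dl -> `|f x' - f y| < e.
  move=> x _.
  have /cvgrPdist_lt /(_ (e / 2)) : f z @[z --> x] --> f x by exact: cf.
  rewrite divr_gt0// => /(_ isT) /nbhs_ballP[dl /= dl0 xdl].
  have dl2 : 0 < dl / 2 by rewrite divr_gt0.
  exists (ball x (dl / 2), [set z | z < dl / 2]) => /=.
    split; first exact: nbhsx_ballx.
    exact: nbhs_right_lt.
  move=> [x' z] [/= xx' zd] y x'y.
  have fx' : `|f x - f x'| < e / 2.
    by apply: xdl; apply: le_ball xx'; rewrite ler_pdivrMr// mulr2n mulrDr mulr1 lerDl ltW.
  have fy : `|f x - f y| < e / 2.
    apply: xdl; rewrite -ball_normE /=; rewrite -ball_normE /= in xx'.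
    rewrite (splitr dl) (_ : x - y = (x - x') + (x' - y)); last by rewrite addrA subrK.
    by apply: (le_lt_trans (ler_normD _ _)); rewrite ltrD// (lt_trans x'y).
  rewrite (splitr e) (_ : f x' - f y = (f x - f y) - (f x - f x')); last by ring.
  by apply: (le_lt_trans (ler_normB _ _)); rewrite ltrD.
move=> /(_ _ H) h.
have [dl [dl0 Hdl]] := filter_ex (filterI (nbhs_right_gt (0 : R)) h).
by exists dl => // x y xr; exact: Hdl.
Qed.

End row_vectors.

Section half_spaces.
Context {R : realType} {n : nat}.

Definition half_space (k : nat) : set 'rV[R]_n :=
  if (unpickle k : option ('I_n * rat)) is Some (i, q)
  then [set x | x 0 i < ratr q] else set0.

Lemma measurable_half_space k : measurable (half_space k).
Proof.
rewrite /half_space; case: (unpickle k) => [[i q]|//].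
have : measurable (setT `&` (fun x : 'rV[R]_n => x 0 i) @^-1` `]-oo, ratr q[).
  by apply: measurable_coord.
by rewrite setTI; congr measurable.
Qed.

(** Among the questions are the comparisons of every coordinate with a grid of
mesh 1/N < e that covers the ball of radius r.  Two points with equal answers
have all coordinates in a common grid interval; only the first point has to lie
in the ball. *)
Lemma code_half_space_separates (r e : R) : 0 < e -> exists m, forall x y,
  `|x| <= r -> code half_space m x = code half_space m y -> `|x - y| < e.
Proof.
move=> e0.
pose N := (Num.truncn e^-1).+1.
have N0 : 0 < N%:R :> R by rewrite ltr0n.
have Ne : N%:R^-1 < e.
  rewrite invf_plt ?posrE//; have := @truncnS_gt R e^-1; exact.
pose K := ((Num.truncn `|r|).+1 * N)%N.
have Kr : `|r| * N%:R < K%:R.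
  by rewrite natrM ltr_pM2r// truncnS_gt.
pose q (j : nat) : rat := (j%:R - K%:R) / N%:R.
have qE j : ratr (q j) = (j%:R - K%:R) / N%:R :> R.
  by rewrite /q fmorph_div/= rmorphB/= !ratr_nat.
pose m := (\max_(i < n) \max_(j < (K + K).+2) pickle (i, q j)).+1.
exists m => x y xr cxy; have xy := codeP cxy.
have hs i (j : 'I_(K + K).+2) : (x 0 i < ratr (q j)) <-> (y 0 i < ratr (q j)).
  have := xy (pickle (i, q j)); rewrite /half_space pickleK; apply.
  rewrite ltnS; apply: leq_trans (leq_bigmax i).
  exact: (leq_bigmax (F := fun j : 'I_(K + K).+2 => pickle (i, q j)) j).
apply: rV_norm_lt => // i; rewrite !mxE.
(* The position of the i-th coordinate in the grid, counted from its left end. *)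
pose a := x 0 i * N%:R + K%:R.
have aK : 0 <= a <= (K + K)%:R.
  have := ler_coord_norm x i; rewrite ler_norml => /andP[].
  have := ler_norm r; rewrite natrD /a => ? ? ?.
  have h1 : x 0 i * N%:R <= `|r| * N%:R by rewrite ler_pM2r//; lra.
  have h2 : - `|r| * N%:R <= x 0 i * N%:R by rewrite ler_pM2r//; lra.
  by apply/andP; split; nra.
have /andP[a0 a1] := aK.
have /truncn_itv/andP[ta1 ta2] := a0.
pose j := Num.truncn a.
have jK : (j.+1 < (K + K).+2)%N.
  by rewrite ltnS ltnS -(@ler_nat R); exact: le_trans a1.
have h1 := hs i (Ordinal (ltnW jK)); have h2 := hs i (Ordinal jK).
rewrite /= !qE in h1 h2.
have xj : x 0 i < (j.+1%:R - K%:R) / N%:R.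
  by rewrite ltr_pdivlMr// ltrBrDr.
have xj' : (j%:R - K%:R) / N%:R <= x 0 i.
  by rewrite ler_pdivrMr// lerBlDr.
have yj : y 0 i < (j.+1%:R - K%:R) / N%:R by apply/h2.
have yj' : (j%:R - K%:R) / N%:R <= y 0 i.
  by rewrite leNgt; apply/negP => /h1; rewrite ltNge xj'.
have e1 : (j.+1%:R - K%:R) / N%:R = (j%:R - K%:R) / N%:R + N%:R^-1 :> R.
  by rewrite -natr1; field; lra.
rewrite e1 in xj yj.
by rewrite ltr_norml; apply/andP; split; lra.
Qed.

End half_spaces.

(** * Prokhorov's theorem on row vectors *)

Lemma borel_measurable_real d (T : measurableType d) (R : realType) (f : T -> R) :
  (forall B, open B -> measurable (f @^-1` B)) -> measurable_fun setT f.
Proof.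
move=> fo; apply: (measurability _ (RGenOpens.measurableE R)).
move=> _ [_ [a [b ->] <-]]; rewrite setTI; apply: fo; exact: interval_open.
Qed.

Lemma continuous_measurable_rV (R : realType) n (f : 'rV[R]_n -> R) :
  continuous f -> measurable_fun setT f.
Proof.
move=> cf; apply: borel_measurable_real => B oB; apply: open_measurable_mx.
by apply: open_comp => // x _; exact: cf.
Qed.

Lemma integrable_bounded_fun d (T : measurableType d) (R : realType)
    (mu : probability T R) (f : T -> R) (M : R) :
  measurable_fun setT f -> (forall x, `|f x| <= M) ->
  mu.-integrable setT (EFin \o f).
Proof.
move=> mf fM; apply: measurable_bounded_integrable => //.
  by rewrite (le_lt_trans (probability_le1 _ _))// ltry.
exists M; split; first exact: num_real.
by move=> N MN x _ /=; exact: le_trans (ltW MN).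
Qed.

Lemma distr_le_cst (R : realType) d (T : measurableType d) (mu : probability T R)
    (f g : T -> R) (B : set T) (M e : R) :
  measurable B -> measurable_fun setT f -> measurable_fun setT g ->
  (forall x, `|f x| <= M) -> (forall x, `|g x| <= M) ->
  (forall x, ~ B x -> `|f x - g x| <= e) -> 0 <= e ->
  `|\int[mu]_x f x - \int[mu]_x g x| <= e + 2 * M * fine (mu B).
Proof.
move=> mB mf mg fM gM fg e0.
have i1 := integrable_bounded_fun mu mf fM.
have i2 := integrable_bounded_fun mu mg gM.
have i3 := integrableB measurableT i1 i2.
rewrite -RintegralB//; apply: (le_trans (le_normr_Rintegral _ _)) => //.
have M0 : 0 <= M by have [x|T0] := pselect (exists x : T, True);
  [have [x0 _] := x; exact: le_trans (fM x0)|exact: (le_trans _ (fM point))].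
have iB : mu.-integrable setT (EFin \o (fun x => 2 * M * \1_B x)).
  exact: (integrableZl measurableT (2 * M) (integrable_indic mu mB)).
have ie : mu.-integrable setT (EFin \o cst e).
  exact: finite_measure_integrable_cst.
have -> : e + 2 * M * fine (mu B) = \int[mu]_x (cst e x + 2 * M * \1_B x).
  rewrite RintegralD// RintegralZl//; last exact: integrable_indic.
  rewrite Rintegral_cst// [fine (mu setT)](_ : _ = 1) ?mulr1; last by rewrite probability_setT.
  by rewrite /Rintegral integral_indic// setIT.
apply: le_Rintegral => //.
- exact: (integrable_norm i3).
- exact: (integrableD measurableT ie iB).
- move=> x _ /=; have [xB|xB] := pselect (B x).
    rewrite indicE mem_set// mulr1 (le_trans (ler_normB _ _))//.
    have := fM x; have := gM x; lra.
  by rewrite indicE memNset// mulr0 addr0; exact: fg.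
Qed.

Section skorokhod.
Context {R : realType} {n : nat}.
Variable mu_ : nat -> probability 'rV[R]_n R.
Hypothesis tight : forall e : R, 0 < e ->
  exists r : R, forall k, (mu_ k [set x : 'rV[R]_n | (r < `|x|)%R] <= e%:E)%E.

Notation U := (@half_space R n).
Let mU := @measurable_code _ _ _ (@measurable_half_space R n).

Let a (k : nat) (w : seq bool) : R :=
  fine (mu_ k [set x | code U (size w) x = w]).

Let a_ge0 k w : 0 <= a k w.
Proof. by rewrite fine_ge0. Qed.

Let a_nil k : a k [::] = 1.
Proof.
rewrite /a /= (_ : [set _ | _] = setT) ?probability_setT//.
by apply/seteqP; split.
Qed.

Let a_split k w : a k w = a k (false :: w) + a k (true :: w).
Proof.
rewrite /a -fineD ?fin_num_measure// -measureU//; last first.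
  by apply/seteqP; split=> // x [/= [+ _] [+ _]] => ->.
congr (fine (mu_ k _)); apply/seteqP; split => x /=.
  by move=> ->; case: asboolP => h; [right|left].
by move=> [[_ ->]|[_ ->]].
Qed.

Variables (phi : nat -> nat) (p : seq bool -> R).
Hypothesis acvg : forall w, a (phi k) w @[k --> \oo] --> p w.

Let p_nil : p [::] = 1.
Proof.
have := @acvg [::].
rewrite [X in X @ _](_ : _ = cst 1); last by apply/funext => k; exact: a_nil.
by move=> /(cvg_lim (@Rhausdorff R)); rewrite lim_cst.
Qed.

Let p_ge0 w : 0 <= p w.
Proof.
rewrite -(cvg_lim (@Rhausdorff R) (@acvg w)).
by apply: limr_ge; [exact: cvgP (@acvg w)|exact: nearW].
Qed.

Let p_split w : p w = p (false :: w) + p (true :: w).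
Proof.
have h : a (phi k) w @[k --> \oo] --> p (false :: w) + p (true :: w).
  rewrite [X in X @ _](_ : _ = fun k => a (phi k) (false :: w) + a (phi k) (true :: w)).
    exact: cvgD (@acvg _) (@acvg _).
  by apply/funext => k; rewrite a_split.
by rewrite -(cvg_lim (@Rhausdorff R) h) (cvg_lim (@Rhausdorff R) (@acvg w)).
Qed.

(** The law of the random word of length m is the limit of the laws of the codes
of length m: both integrals are finite sums over words. *)
Let draw_cvg m (c : seq bool -> R) :
  \int[mu_ (phi k)]_x (c (code U m x)) @[k --> \oo] -->
  \int[unif01]_t (c (draw p m t)).
Proof.
rewrite /Rintegral (integral_word (size_draw p m) (@measurable_draw _ p m)).
under eq_cvg do rewrite (integral_word (size_code U m) (mU m)).
rewrite /=; apply: (cvg_big add_continuous) => w _; apply: cvgMr.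
have := unif01_draw p_nil p_ge0 p_split w; rewrite size_tuple => -> /=.
by have := @acvg w; rewrite /a size_tuple.
Qed.

Let pt (w : seq bool) : 'rV[R]_n := xget 0 [set x | code U (size w) x = w].

Let ptP m x w : code U m x = w -> code U m (pt w) = w.
Proof.
move=> xw; have mw : m = size w by rewrite -xw size_code.
rewrite mw /pt; apply: (@xgetPex _ (0 : 'rV[R]_n) [set y | code U (size w) y = w]).
by exists x; rewrite /= -mw.
Qed.

Let Z m t := pt (draw p m t).

(** The limit of the points Z m t, taken with an upper limit so that it is a
measurable function of t even where the sequence diverges. *)
Let X t : 'rV[R]_n := \row_i fine (limn_esup (fun m => (Z m t 0 i)%:E)).

Let measurable_Z m i : measurable_fun setT (fun t => Z m t 0 i).
Proof.
exact: (measurable_fun_word (size_draw p m) (@measurable_draw _ p m)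
  (fun w => pt w 0 i)).
Qed.

Let measurable_X : measurable_fun setT X.
Proof.
apply: measurable_fun_mx => i j; rewrite ord1.
under eq_fun do rewrite mxE.
apply: measurableT_comp; first exact: fine_measurable.
apply: measurable_fun_limn_esup => m; apply/measurable_EFinP; exact: measurable_Z.
Qed.

Let visits (r : R) m (w : seq bool) := exists x, `|x| <= r /\ code U m x = w.

Let far (r : R) m := [set t | ~ visits r m (draw p m t)].

Let measurable_far r m : measurable (far r m).
Proof.
exact: (measurable_word_set (R := R) (size_draw p m) (@measurable_draw _ p m)
  [set w | ~ visits r m w]).
Qed.

(** A cell that misses the ball lies in its complement, whose mass is at most e
along the sequence; the bound passes to the limit word. *)
Let far_le (r e : R) m :
  (forall k, (mu_ k [set x : 'rV[R]_n | (r < `|x|)%R] <= e%:E)%E) ->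
  (unif01 (far r m) <= e%:E)%E.
Proof.
move=> hr; pose Q := [set w | ~ visits r m w].
have := @draw_cvg m (\1_Q).
rewrite (Rintegral_word_set (size_draw p m) (@measurable_draw _ p m)) => h.
rewrite -[leLHS]fineK ?fin_num_measure// lee_fin.
rewrite -(cvg_lim (@Rhausdorff R) h); apply: limr_le; first exact: cvgP h.
apply: nearW => k; rewrite (Rintegral_word_set (size_code U m) (mU m)).
have mV := measurable_word_set (R := R) (size_code U m) (mU m) Q.
rewrite -lee_fin fineK ?fin_num_measure//; apply: le_trans (hr (phi k)).
apply: le_measure; rewrite ?inE//; first exact: measurable_norm_gt.
move=> x /= nv; rewrite ltNge; apply/negP => xr; apply: nv; by exists x.
Qed.

Let draw_code m m' t x : (m <= m')%N ->
  code U m' x = draw p m' t -> code U m x = draw p m t.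
Proof.
move=> mm'; rewrite -(subnK mm'); elim: (m' - m)%N => // k IH.
by rewrite addSn => -[_]; exact: IH.
Qed.

Let good := [set t | exists r, forall m, visits r m (draw p m t)].

(** The cells of the prefixes decrease, so the events of missing a fixed ball
increase with the length, and their union is as unlikely as the complement of
the ball. *)
Let ae_good : \forall t \ae unif01, good t.
Proof.
have /choice[r rP] (j : nat) : exists r : R, forall k,
    (mu_ k [set x : 'rV[R]_n | (r < `|x|)%R] <= j.+1%:R^-1%:E)%E.
  by apply: tight; rewrite invr_gt0.
pose B j := \bigcup_m far (r j) m.
have mB j : measurable (B j) by exact: bigcup_measurable.
exists (\bigcap_j B j); split.
- exact: bigcap_measurable.
- apply/eqP; rewrite eq_le measure_ge0 andbT; apply/lee_addgt0Pr => e e0.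
  rewrite add0e.
  have [j je] : exists j, j.+1%:R^-1 < e :> R.
    have /filter_ex[j] := near_infty_natSinv_lt (PosNum e0); by exists j.
  apply: (@le_trans _ _ (unif01 (B j))).
    by apply: le_measure; rewrite ?inE//; [exact: bigcap_measurable|exact: bigcap_inf].
  apply: (@le_trans _ _ j.+1%:R^-1%:E); last by rewrite lee_fin ltW.
  have nd : {homo far (r j) : m m' / (m <= m')%N >-> (m <= m')%O}.
    move=> m m' mm'; apply/subsetPset => t nv [x [xr xt]]; apply: nv.
    by exists x; split=> //; exact: draw_code xt.
  have h := nondecreasing_cvg_mu (mu := unif01) (measurable_far (r j)) (mB j) nd.
  rewrite -(cvg_lim _ h)//; apply: lime_le; first exact: cvgP h.
  by apply: nearW => m /=; exact: far_le (rP j).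
- move=> t /= ng j _; apply: contra_notP ng => nB; exists (r j) => m.
  by apply: contra_notP nB => nv; exists m.
Qed.

(** Once the cell of a prefix is small and meets the ball, all later points
are close to a point of that cell. *)
Let good_cvg t : good t -> Z m t @[m --> \oo] --> X t.
Proof.
move=> [r vis].
have cZ : cvg (Z m t @[m --> \oo]).
  apply: cauchy_cvg; apply: cauchy_exP => e e0.
  have [m sep] := @code_half_space_separates R n r e e0.
  have [x [xr xt]] := vis m; exists x.
  exists m => // m' /= mm'; rewrite -ball_normE /=; apply: sep => //.
  have [x' [_ xt']] := vis m'.
  by rewrite xt; symmetry; apply: (draw_code mm'); exact: ptP xt'.
rewrite (_ : X t = lim (Z m t @[m --> \oo])) //.
apply/rowP => i; rewrite mxE.
have : (Z m t 0 i)%:E @[m --> \oo] --> (lim (Z m t @[m --> \oo]) 0 i)%:E.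
  apply: cvg_EFin; first exact: nearW.
  apply: (cvg_comp _ (fun z : 'rV[R]_n => z 0 i) cZ); exact: coord_continuous.
by move=> /cvg_limn_einf_sup[_ ->].
Qed.

(** The integral of f is compared with that of the step function f \o pt on
cells: the difference is small uniformly in k for long words by uniform
continuity on a ball and tightness, the step functions converge in k by
[draw_cvg], and in m by dominated convergence. *)
Theorem prokhorov_limit : exists mu : probability 'rV[R]_n R,
  forall f : 'rV[R]_n -> R, continuous f -> (exists M : R, forall x, `|f x| <= M) ->
    (\int[mu_ (phi k)]_x (f x)%:E)%E @[k --> \oo] --> (\int[mu]_x (f x)%:E)%E.
Proof.
pose XX : {mfun _ >-> _} := HB.pack X (isMeasurableFun.Build _ _ _ _ X measurable_X).
exists (distribution unif01 XX) => f cf [M fM].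
have mf := continuous_measurable_rV cf.
have mfX : measurable_fun setT (f \o X) by exact: measurableT_comp mf measurable_X.
have ifX := integrable_bounded_fun unif01 mfX (fun t => fM (X t)).
rewrite integral_distribution//; last exact/measurable_EFinP.
have if_ k := integrable_bounded_fun (mu_ (phi k)) mf fM.
have -> : (fun k => \int[mu_ (phi k)]_x (f x)%:E)%E =
    EFin \o (fun k => \int[mu_ (phi k)]_x f x).
  apply/funext => k /=; rewrite /Rintegral fineK//.
  exact: (integrable_fin_num measurableT (if_ k)).
have -> : (\int[unif01]_t ((EFin \o f) \o XX) t)%E = (\int[unif01]_t f (X t))%:E.
  by rewrite /Rintegral fineK//; exact: (integrable_fin_num measurableT ifX).
apply: cvg_EFin; first exact: nearW.
have J'cvg : \int[unif01]_t f (Z m t) @[m --> \oo] --> \int[unif01]_t f (X t).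
  have mfZ m : measurable_fun setT (fun t => f (Z m t)).
    exact: (measurable_fun_word (size_draw p m) (@measurable_draw _ p m) (f \o pt)).
  have ae_cvg : \forall t \ae unif01, setT t ->
      (f (Z m t))%:E @[m --> \oo] --> (f (X t))%:E.
    apply: filterS ae_good => t gt _; apply: cvg_EFin; first exact: nearW.
    by apply: continuous_cvg; [exact: cf|exact: good_cvg].
  have iM : unif01.-integrable setT (EFin \o cst M).
    exact: finite_measure_integrable_cst.
  have ae_le : \forall t \ae unif01, forall m, setT t -> (`|(f (Z m t))%:E| <= M%:E)%E.
    by apply: nearW => t m _; rewrite lee_fin.
  have mE m : measurable_fun setT (fun t => (f (Z m t))%:E).
    by apply/measurable_EFinP; exact: mfZ.
  have [_ _ dct] := dominated_convergence measurableT mE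
    (measurable_int _ ifX) ae_cvg iM ae_le.
  have eX : (\int[unif01]_t (f (X t))%:E)%E = (\int[unif01]_t f (X t))%:E.
    by rewrite /Rintegral fineK//; exact: (integrable_fin_num measurableT ifX).
  by rewrite eX in dct; exact: fine_cvg dct.
have M0 : 0 <= M := le_trans (normr_ge0 _) (fM 0).
apply/cvgrPdist_lt => e e0.
pose eta := e / (4 * (1 + 2 * M)).
have eta0 : 0 < eta by rewrite divr_gt0// mulr_gt0//; lra.
have etaE : eta + 2 * M * eta = e / 4 by rewrite /eta; field; lra.
have [r hr] := tight eta0.
have [dl dl0 hdl] := continuous_uniform_le r cf eta0.
have [m0 sep] := @code_half_space_separates R n r dl dl0.
have /cvgrPdist_lt /(_ (e / 4)) := J'cvg.
rewrite divr_gt0// => /(_ isT) [m1 _ hm1].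
pose m := maxn m0 m1.
have /cvgrPdist_lt /(_ (e / 4)) := @draw_cvg m (f \o pt).
rewrite divr_gt0// => /(_ isT).
apply: filterS => k hk.
have L1 := hm1 m (leq_maxr _ _).
pose B := [set x : 'rV[R]_n | r < `|x|].
have mB : measurable B by exact: measurable_norm_gt.
have L2 : `|\int[mu_ (phi k)]_x f x - \int[mu_ (phi k)]_x f (pt (code U m x))| <= e / 4.
  have h := distr_le_cst (mu_ (phi k)) mB mf
    (measurable_fun_word (size_code U m) (mU m) (f \o pt)) fM (fun x => fM _) _ (ltW eta0).
  apply: (le_trans (h _)); last first.
    rewrite -etaE lerD2l ler_wpM2l//; first lra.
    by rewrite -lee_fin fineK ?fin_num_measure.
  move=> x /negP; rewrite -leNgt => xr; apply/ltW/hdl => //; apply: sep => //.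
  by apply: (@code_le _ _ _ m); [exact: leq_maxl|rewrite (ptP (erefl _))].
move: hk L1 L2; rewrite /Z /=.
set a1 := \int[unif01]_t _; set a2 := Rintegral _ _ _; set a3 := Rintegral _ _ _.
set a4 := Rintegral _ _ _.
rewrite !ltr_norml !ler_norml => /andP[? ?] /andP[? ?] /andP[? ?].
by apply/andP; split; lra.
Qed.

End skorokhod.

Theorem prokhorov_rV (R : realType) n (mu_ : nat -> probability 'rV[R]_n R) :
  (forall e : R, 0 < e -> exists r : R, forall k,
     (mu_ k [set x : 'rV[R]_n | (r < `|x|)%R] <= e%:E)%E) ->
  exists (phi : nat -> nat) (mu : probability 'rV[R]_n R),
    {homo phi : i j / (i < j)%N} /\
      forall f : 'rV[R]_n -> R, continuous f ->
        (exists M : R, forall x, `|f x| <= M) ->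
        (\int[mu_ (phi k)]_x (f x)%:E)%E @[k --> \oo] -->
        (\int[mu]_x (f x)%:E)%E.
Proof.
move=> tight.
pose a k w := fine (mu_ k [set x | code (@half_space R n) (size w) x = w]).
have a01 k w : 0 <= a k w <= 1.
  rewrite fine_ge0//= -lee_fin fineK ?probability_le1//.
  - exact: measurable_code (@measurable_half_space R n) _ _.
  - by rewrite fin_num_measure//; exact: measurable_code (@measurable_half_space R n) _ _.
have [phi [p [phi_incr acvg]]] := diagonal_subsequence a01.
have [mu muP] := prokhorov_limit tight acvg.
by exists phi, mu; split.
Qed.

(** * Moments of a Gaussian law *)

Section density.
Import HBNNSimple.
Local Open Scope ereal_scope.

(** A measure with density g integrates simple functions below f as g times
them, hence at most as f * g; monotone approximation does the rest. *)
Lemma ge0_integral_density_le d (T : measurableType d) (R : realType)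
    (mu nu : {measure set T -> \bar R}) (g : T -> R) (f : T -> \bar R) :
  measurable_fun setT g -> (forall x, 0 <= g x)%R ->
  (forall A, measurable A -> nu A = \int[mu]_(x in A) (g x)%:E) ->
  measurable_fun setT f -> (forall x, 0 <= f x) ->
  \int[nu]_x f x <= \int[mu]_x (f x * (g x)%:E).
Proof.
move=> mg g0 nuE mf f0.
pose h := nnsfun_approx measurableT mf.
have hf x : (EFin \o h ^~ x) @ \oo --> f x by exact: cvg_nnsfun_approx.
have hnd x : {homo h ^~ x : n m / (n <= m)%N >-> (n <= m)%R}.
  by move=> n m nm; exact/lefP/nd_nnsfun_approx.
have hle n x : (h n x)%:E <= f x.
  rewrite -(cvg_lim _ (hf x))//; apply: lime_ge; first exact: cvgP (hf x).
  by exists n => // m /= nm; rewrite lee_fin hnd.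
rewrite (nd_ge0_integral_lim nu f0 hnd hf).
apply: lime_le.
  apply: ereal_nondecreasing_is_cvgn => n m nm.
  by apply: le_sintegral => x; exact: hnd.
apply: nearW => n /=; rewrite sintegralE.
have mE : measurable_fun setT (EFin \o g) by exact/measurable_EFinP.
rewrite (eq_fsbigr (fun y => \int[mu]_x ((y * \1_(h n @^-1` [set y]) x)%:E * (g x)%:E))).
  rewrite -ge0_integral_fsum//.
  - apply: ge0_le_integral => //.
    + move=> x _; apply: fsume_ge0 => y _; apply: mule_ge0; last by rewrite lee_fin.
      exact: nnfun_muleindic_ge0.
    + apply: emeasurable_fsum => // y; apply: emeasurable_funM => //.
      by apply/measurable_EFinP; exact: measurable_funM.
    + exact: emeasurable_funM.
    + move=> x _; rewrite -ge0_mule_fsuml; last by move=> y; exact: nnfun_muleindic_ge0.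
      by rewrite fsumEFin// -fimfunE lee_wpmul2r ?lee_fin//; exact: hle.
  - move=> y; apply: emeasurable_funM => //; apply/measurable_EFinP.
    exact: measurable_funM.
  - move=> y x _; apply: mule_ge0; last by rewrite lee_fin.
    exact: nnfun_muleindic_ge0.
move=> y /set_mem[x _ <-]; rewrite nuE//.
under [RHS]eq_integral do rewrite EFinM -muleA.
rewrite ge0_integralZl ?lee_fin//; last 2 first.
- by apply: emeasurable_funM => //; apply/measurable_EFinP.
- by move=> z _; rewrite mule_ge0 ?lee_fin.
rewrite integral_mkcond; congr (_ * _); apply: eq_integral => z _.
by rewrite /patch indicE; case: ifPn => _; rewrite ?mul1e ?mul0e.
Qed.

End density.

(** Apply u <= exp u to u = (2 a / q) y^2 and raise to the power q / 2. *)
Lemma powR_le_expR (R : realType) (a q : R) : 0 < a -> 0 < q ->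
  exists2 C : R, 0 <= C & forall y : R, `|y| `^ q <= C * expR (a * y ^+ 2).
Proof.
move=> a0 q0; pose b := 2 * a / q.
have b0 : 0 < b by rewrite divr_gt0// mulr_gt0.
exists (b^-1 `^ (q / 2)); first exact: powR_ge0.
move=> y.
have -> : `|y| `^ q = (b^-1 * (b * y ^+ 2)) `^ (q / 2).
  rewrite mulKf ?gt_eqF// -real_normK ?num_real// -powR_mulrn// -powRrM.
  by congr (_ `^ _); field.
rewrite powRM ?invr_ge0 ?(ltW b0)//; last by rewrite mulr_ge0 ?sqr_ge0// ltW.
rewrite ler_wpM2l ?powR_ge0//.
have -> : a * y ^+ 2 = b * y ^+ 2 * (q / 2) by rewrite /b; field; lra.
rewrite expRM; apply: ge0_ler_powR; rewrite ?nnegrE ?expR_ge0//.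
- by rewrite divr_ge0// ltW.
- by rewrite mulr_ge0 ?sqr_ge0// ltW.
- have := expR_ge1Dx (b * y ^+ 2); lra.
Qed.

(** The power is absorbed by exp (y^2 / (4 s^2)), which turns the density of
standard deviation s into a multiple of the one of standard deviation
sqrt 2 * s. *)
Lemma normal_prob_moment (R : realType) (s q : R) : 0 < s -> 0 < q ->
  (\int[normal_prob 0 s]_y (`|y| `^ q)%:E < +oo)%E.
Proof.
move=> s0 q0.
have mq : measurable_fun setT (fun y : R => (`|y| `^ q)%:E).
  apply/measurable_EFinP; apply: (measurableT_comp (measurable_powR _)).
  exact: normr_measurable.
apply: (@le_lt_trans _ _
    (\int[lebesgue_measure]_y ((`|y| `^ q)%:E * (normal_pdf 0 s y)%:E))%E).
  have nuE A : measurable A ->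
      normal_prob 0 s A = (\int[lebesgue_measure]_(x in A) (normal_pdf 0 s x)%:E)%E by [].
  have y0 (y : R) : (0 <= (`|y| `^ q)%:E)%E by rewrite lee_fin powR_ge0.
  exact: (@ge0_integral_density_le _ (measurableTypeR R) R lebesgue_measure (normal_prob 0 s)
    (normal_pdf 0 s) _ (measurable_normal_pdf 0 s) (normal_pdf_ge0 0 s) nuE mq y0).
have a0 : 0 < (4 * s ^+ 2)^-1 by rewrite invr_gt0 mulr_gt0// exprn_gt0.
have [C C0 hC] := powR_le_expR a0 q0.
pose t := Num.sqrt 2 * s.
have t0 : 0 < t by rewrite mulr_gt0// sqrtr_gt0.
pose K := C * normal_peak s / normal_peak t.
have pk : 0 < normal_peak t by rewrite normal_peak_gt0// gt_eqF.
apply: (@le_lt_trans _ _ (\int[lebesgue_measure]_y (K%:E * (normal_pdf 0 t y)%:E))%E).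
  apply: ge0_le_integral => //.
  - by move=> y _; rewrite mule_ge0// lee_fin ?powR_ge0 ?normal_pdf_ge0.
  - apply: emeasurable_funM => //; apply/measurable_EFinP; exact: measurable_normal_pdf.
  - apply/measurable_funeM/measurable_EFinP; exact: measurable_normal_pdf.
  - move=> y _; rewrite -!EFinM lee_fin !normal_pdfE ?gt_eqF//.
    have e1 : normal_fun 0 t y = expR ((4 * s ^+ 2)^-1 * y ^+ 2) * normal_fun 0 s y.
      rewrite /normal_fun -expRD; congr expR.
      rewrite subr0 /t exprMn sqr_sqrtr//; field; lra.
    rewrite e1 (_ : K * _ =
      C * expR ((4 * s ^+ 2)^-1 * y ^+ 2) * (normal_peak s * normal_fun 0 s y)).
      by rewrite ler_wpM2r// mulr_ge0 ?normal_peak_ge0// expR_ge0.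
    by rewrite /K; field; rewrite gt_eqF.
rewrite integralZl//; last exact: integrable_normal_pdf.
by rewrite integral_normal_pdf mule1 ltry.
Qed.

(** * Norms on a finite-dimensional space *)

Section finite_dimensional_norms.
Context {R : realType} {X : vectType R}.
Variable N : X -> R.
Hypothesis N_triangle : forall u v, N (u + v) <= N u + N v.
Hypothesis N_scale : forall a u, N (a *: u) = `|a| * N u.

Lemma seminorm0 : N 0 = 0.
Proof. by rewrite -(scale0r (0 : X)) N_scale normr0 mul0r. Qed.

Lemma seminorm_ge0 u : 0 <= N u.
Proof.
have := N_triangle u (- 1 *: u).
by rewrite N_scale normrN1 mul1r scaleN1r subrr seminorm0 => h; lra.
Qed.

Lemma seminorm_le_coord : exists2 C : R, 0 <= C & forall v, N v <= C * `|v2r v|.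
Proof.
exists (\sum_i N (r2v (delta_mx 0 i))).
  by apply: sumr_ge0 => i _; exact: seminorm_ge0.
move=> v; rewrite -[in leLHS](v2rK v) [in leLHS](row_sum_delta (v2r v)) linear_sum/=.
rewrite mulr_suml.
elim/big_ind2 : _ => [|x1 x2 y1 y2 h1 h2|i _].
- by rewrite seminorm0.
- by apply: (le_trans (N_triangle _ _)); exact: lerD.
- rewrite linearZ/= N_scale mulrC ler_wpM2l ?seminorm_ge0//.
  exact: ler_coord_norm.
Qed.

(** The norm is Lipschitz in the coordinates, so it has a minimum on the compact
unit sphere of the coordinate norm, and the minimum is not zero. *)
Lemma norm_ge_coord : (forall u, N u = 0 -> u = 0) ->
  exists2 c : R, 0 < c & forall v, c * `|v2r v| <= N v.
Proof.
move=> N_eq0; have [C C0 NC] := seminorm_le_coord.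
pose f (x : 'rV[R]_(dim X)) := N (r2v x).
have f_lip x y : `|f x - f y| <= C * `|x - y|.
  have h a b : f a - f b <= C * `|a - b|.
    rewrite lerBlDr /f -{1}(subrK b a) linearD/=.
    by apply: (le_trans (N_triangle _ _)); rewrite lerD2r -[x in `|x|]r2vK.
  by rewrite ler_norml h andbT lerNl opprB -normrN opprB h.
have f_cont : continuous f.
  move=> x A /nbhs_ballP[e /= e0 eA]; apply/nbhs_ballP.
  exists (e / (C + 1)) => /=; first by rewrite divr_gt0//; lra.
  move=> y; rewrite -ball_normE /= => xy; apply: eA; rewrite -ball_normE /=.
  apply: (le_lt_trans (f_lip _ _)).
  apply: (@le_lt_trans _ _ ((C + 1) * `|x - y|)); first by rewrite ler_wpM2r//; lra.
  by rewrite mulrC -ltr_pdivlMr//; lra.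
pose sph := [set x : 'rV[R]_(dim X) | `|x| = 1].
(* The sphere is empty when the space is trivial. *)
have [[x0 x01]|nsph] := pselect (exists x, sph x); last first.
  exists 1 => // v; rewrite mul1r.
  have [->|v0] := eqVneq (v2r v) 0; first by rewrite normr0 seminorm_ge0.
  by exfalso; apply: nsph; exists (`|v2r v|^-1 *: v2r v); rewrite /sph /= normrZ normfV normr_id mulVf// normr_eq0.
have csph : compact sph.
  apply: (@subclosed_compact _ _ [set x | `|x| <= 1]).
  - apply: (@closed_comp _ _ (fun x : 'rV[R]_(dim X) => `|x|) [set 1]).
      by move=> x _; exact: norm_continuous.
    exact: closed_eq.
  - exact: compact_norm_le.
  - by move=> x /= ->.
have [|x1 /set_mem x11 x1min] := EVT_min_rV _ csph (continuous_subspaceT f_cont).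
  by exists x0.
have fx1 : 0 < f x1.
  rewrite lt0r seminorm_ge0 andbT; apply/eqP => /N_eq0 x10.
  have := x11; rewrite /sph /= -(r2vK x1) x10 linear0 normr0 => /esym/eqP.
  by rewrite oner_eq0.
exists (f x1) => // v.
have [->|v0] := eqVneq (v2r v) 0; first by rewrite normr0 mulr0 seminorm_ge0.
have nv : 0 < `|v2r v| by rewrite normr_gt0.
have := x1min (`|v2r v|^-1 *: v2r v).
rewrite [f (_ *: _)]/f linearZ/= v2rK N_scale normfV normr_id => h.
rewrite -ler_pdivlMr// mulrC; apply: h; rewrite inE /sph /=.
by rewrite normrZ normfV normr_id mulVf// gt_eqF.
Qed.

End finite_dimensional_norms.

(** * Integrals up to null sets *)

Section almost_everywhere.
Context d (T : measurableType d) (R : realType) (mu : {measure set T -> \bar R}).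
Implicit Types f g : T -> R.

Lemma ae_eq_Rintegral f g : measurable_fun setT f -> measurable_fun setT g ->
  (\forall x \ae mu, f x = g x) -> \int[mu]_x f x = \int[mu]_x g x.
Proof.
move=> mf mg fg; congr fine; apply: ae_eq_integral => //; try exact/measurable_EFinP.
by apply: filterS fg => x -> _.
Qed.

Lemma measurable_integrable f : mu.-integrable setT (EFin \o f) -> measurable_fun setT f.
Proof. by move=> /measurable_int /measurable_EFinP. Qed.

Lemma ae_le_Rintegral f g :
  mu.-integrable setT (EFin \o f) -> mu.-integrable setT (EFin \o g) ->
  (\forall x \ae mu, f x <= g x) -> \int[mu]_x f x <= \int[mu]_x g x.
Proof.
move=> if_ ig fg; rewrite -subr_ge0 -RintegralB//.
have mgf : measurable_fun setT (fun x => g x - f x).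
  by apply: measurable_funB; exact: measurable_integrable.
rewrite (@ae_eq_Rintegral _ (fun x => `|g x - f x|)) ?Rintegral_ge0//.
- exact: measurableT_comp.
- by apply: filterS fg => x fgx; rewrite ger0_norm// subr_ge0.
Qed.

Lemma ae_le_integrable f g :
  measurable_fun setT f -> mu.-integrable setT (EFin \o g) ->
  (\forall x \ae mu, `|f x| <= g x) -> mu.-integrable setT (EFin \o f).
Proof.
move=> mf ig fg; apply/integrableP; split; first exact/measurable_EFinP.
have mg := measurable_integrable ig.
have /integrableP[_] := ig; apply: le_lt_trans.
apply: ae_ge0_le_integral => //.
- by apply: measurableT_comp => //; exact/measurable_EFinP.
- by apply: measurableT_comp => //; exact/measurable_EFinP.
by apply: filterS fg => x fgx _ /=; rewrite lee_fin (le_trans fgx)// ler_norm.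
Qed.

Lemma measurable_norm_powR f (r : R) : measurable_fun setT f ->
  measurable_fun setT (fun x => `|f x| `^ r).
Proof.
move=> mf; apply: (measurableT_comp (measurable_powR r)).
exact: (measurableT_comp (@normr_measurable R setT)).
Qed.

Lemma integrable_powR_finite_norm f (r : R) : measurable_fun setT f ->
  mu.-integrable setT (EFin \o (fun x => `|f x| `^ r)) -> finite_norm mu r%:E f.
Proof.
move=> mf /integrableP[_ fi]; rewrite /finite_norm unlock poweR_lty//.
apply: le_lt_trans fi; apply: ge0_le_integral => //.
- by move=> x _; rewrite poweR_ge0.
- by apply/measurable_EFinP; exact: measurable_norm_powR.
- by apply: measurableT_comp => //; apply/measurable_EFinP; exact: measurable_norm_powR.
- move=> x _ /=; rewrite lee_fin; exact: ler_norm.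
Qed.

End almost_everywhere.

(** * The Euclidean structure on matrices *)

Section euclidean_matrices.
Context {R : realType} {m n : nat}.
Implicit Types A B C : 'M[R]_(m, n).

Lemma mxdotC A B : mxdot A B = mxdot B A.
Proof. by do 2![apply: eq_bigr => ? _]; rewrite mulrC. Qed.

Lemma mxdotDr A B C : mxdot A (B + C) = mxdot A B + mxdot A C.
Proof.
rewrite /mxdot -big_split; apply: eq_bigr => i _; rewrite -big_split.
by apply: eq_bigr => j _; rewrite mxE mulrDr.
Qed.

Lemma mxdotZr a A B : mxdot A (a *: B) = a * mxdot A B.
Proof.
rewrite /mxdot mulr_sumr; apply: eq_bigr => i _; rewrite mulr_sumr.
by apply: eq_bigr => j _; rewrite mxE mulrCA.
Qed.

Lemma mxdotDl A B C : mxdot (A + B) C = mxdot A C + mxdot B C.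
Proof. by rewrite mxdotC mxdotDr !(mxdotC C). Qed.

Lemma mxdotZl a A B : mxdot (a *: A) B = a * mxdot A B.
Proof. by rewrite mxdotC mxdotZr mxdotC. Qed.

Lemma mxdotNr A B : mxdot A (- B) = - mxdot A B.
Proof. by rewrite -scaleN1r mxdotZr mulN1r. Qed.

Lemma mxdotNl A B : mxdot (- A) B = - mxdot A B.
Proof. by rewrite mxdotC mxdotNr mxdotC. Qed.

Lemma mxdotxx A : mxdot A A = frob A ^+ 2.
Proof.
rewrite /frob sqr_sqrtr// /mxdot; do 2![apply: sumr_ge0 => ? _].
by rewrite -expr2 sqr_ge0.
Qed.

(** The Cauchy-Schwarz inequality, read off the square of the triangle
inequality. *)
Lemma mxdot_le A B : mxdot A B <= frob A * frob B.
Proof.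
have := ler_frobD A B.
rewrite -(@ler_pXn2r _ 2)// ?nnegrE ?addr_ge0 ?frob_ge0//.
rewrite -mxdotxx mxdotDr !mxdotDl !mxdotxx (mxdotC B A); nra.
Qed.

Lemma norm_mxdot_le A B : `|mxdot A B| <= frob A * frob B.
Proof.
by rewrite ler_norml mxdot_le andbT lerNl -mxdotNl -(frobN A) mxdot_le.
Qed.

Lemma norm_mxdot_le_sqr A B : `|mxdot A B| <= frob A ^+ 2 + frob B ^+ 2.
Proof.
apply: (le_trans (norm_mxdot_le A B)).
have := sqr_ge0 (frob A - frob B); have := sqr_ge0 (frob A); have := sqr_ge0 (frob B).
nra.
Qed.

Lemma norm_coord_le_frob A i j : `|A i j| <= frob A.
Proof.
rewrite -sqrtr_sqr /frob ler_sqrt; last first.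
  do 2![apply: sumr_ge0 => ? _]; by rewrite -expr2 sqr_ge0.
rewrite /mxdot (bigD1 i)//= (bigD1 j)//= -expr2 -addrA lerDl addr_ge0//.
  by apply: sumr_ge0 => ? _; rewrite -expr2 sqr_ge0.
by do 2![apply: sumr_ge0 => ? _]; rewrite -expr2 sqr_ge0.
Qed.

Lemma frob_le_sum A : frob A <= \sum_i \sum_j `|A i j|.
Proof.
have h0 : 0 <= \sum_i \sum_j `|A i j| by do 2![apply: sumr_ge0 => ? _].
rewrite -(ger0_norm h0) -sqrtr_sqr /frob ler_sqrt ?sqr_ge0// expr2 mulr_suml.
apply: ler_sum => i _; rewrite mulr_suml; apply: ler_sum => j _.
apply: (le_trans (ler_norm _)); rewrite normrM ler_wpM2l//.
rewrite (bigD1 i)//= (bigD1 j)//= -addrA lerDl addr_ge0//.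
  exact: sumr_ge0.
by do 2![apply: sumr_ge0 => ? _].
Qed.

Lemma measurable_mxdot d (T : measurableType d) (f g : T -> 'M[R]_(m, n)) :
  measurable_fun setT f -> measurable_fun setT g ->
  measurable_fun setT (fun x => mxdot (f x) (g x)).
Proof.
move=> mf mg; apply: measurable_sum => i; apply: measurable_sum => j.
by apply: measurable_funM;
  apply: (measurableT_comp (measurable_coord _ _)).
Qed.

End euclidean_matrices.

(** * Coercivity and growth of the stress *)

Lemma powRD_le (R : realType) (a b p : R) : 0 <= a -> 0 <= b -> 0 <= p ->
  (a + b) `^ p <= 2 `^ p * (a `^ p + b `^ p).
Proof.
move=> a0 b0 p0; have [ab|ba] := leP a b.
  apply: (@le_trans _ _ ((2 * b) `^ p)).
    by apply: ge0_ler_powR; rewrite ?nnegrE//; lra.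
  by rewrite powRM// ler_wpM2l ?powR_ge0// lerDr powR_ge0.
apply: (@le_trans _ _ ((2 * a) `^ p)).
  by apply: ge0_ler_powR; rewrite ?nnegrE//; lra.
by rewrite powRM// ler_wpM2l ?powR_ge0// lerDl powR_ge0.
Qed.

Section stress_estimates.
Context {R : realType} {d : nat}.
Variables (p kappa M : R).
Hypotheses (hp : 1 < p) (hkappa : 0 <= kappa) (hM : 0 <= M).
Implicit Types A B Z : 'M[R]_d.

Let p_ge0 : 0 <= p. Proof. exact/ltW/(lt_trans ltr01). Qed.

Let p1_ge0 : 0 <= p - 1. Proof. by rewrite subr_ge0 ltW. Qed.

(** All bounds are stated in terms of s = sqrt (kappa + |Z|^2), for which the
stress is s^(p-2) Z and |Z| <= s; powers of s then combine for all p > 1. *)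
Let s Z := Num.sqrt (kappa + frob Z ^+ 2).

Let sE Z : s Z ^+ 2 = kappa + frob Z ^+ 2.
Proof. by rewrite /s sqr_sqrtr// addr_ge0// sqr_ge0. Qed.

Let s_ge0 Z : 0 <= s Z. Proof. exact: sqrtr_ge0. Qed.

Let frob_le_s Z : frob Z <= s Z.
Proof.
rewrite -(@ler_pXn2r _ 2)// ?nnegrE ?frob_ge0//.
by rewrite sE lerDr.
Qed.

Let s_le Z : s Z <= Num.sqrt kappa + frob Z.
Proof.
have f0 := frob_ge0 Z; have k0 := sqrtr_ge0 kappa.
rewrite -(@ler_pXn2r _ 2)// ?nnegrE ?addr_ge0//.
rewrite sE -[X in X + _](sqr_sqrtr hkappa) sqrrD; nra.
Qed.

Let stressE Z : stress p kappa Z = s Z `^ (p - 2) *: Z.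
Proof.
rewrite /stress /s -powR12_sqrt ?addr_ge0 ?sqr_ge0// -powRrM.
by rewrite [2^-1 * _]mulrC.
Qed.

Let s_pow1 Z : s Z `^ (p - 2) * s Z = s Z `^ (p - 1).
Proof.
rewrite -{2}(powRr1 (s_ge0 Z)) -powRD; first by congr (_ `^ _); ring.
by rewrite gt_eqF //; have := hp; lra.
Qed.

Let s_pow2 Z : s Z `^ (p - 1) * s Z = s Z `^ p.
Proof.
rewrite -{2}(powRr1 (s_ge0 Z)) -powRD; first by congr (_ `^ _); ring.
by rewrite gt_eqF //; have := hp; lra.
Qed.

Let coef_frob_le Z : s Z `^ (p - 2) * frob Z <= s Z `^ (p - 1).
Proof. by rewrite -s_pow1 ler_wpM2l ?powR_ge0// frob_le_s. Qed.

(** If s^2 >= 2 kappa then |Z|^2 = s^2 - kappa >= s^2 / 2; otherwise s^p is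
bounded by the subtracted constant. *)
Let coef_frob2_ge Z :
  2^-1 * s Z `^ p - Num.sqrt (2 * kappa) `^ p <= s Z `^ (p - 2) * frob Z ^+ 2.
Proof.
have c0 : 0 <= s Z `^ (p - 2) := powR_ge0 _ _.
have q0 := powR_ge0 (Num.sqrt (2 * kappa)) p.
have [k2|k2] := leP (2 * kappa) (s Z ^+ 2).
  have e : s Z `^ p = s Z `^ (p - 2) * s Z ^+ 2 by rewrite expr2 mulrA s_pow1 s_pow2.
  have h : s Z `^ (p - 2) * s Z ^+ 2 <= s Z `^ (p - 2) * (2 * frob Z ^+ 2).
    by rewrite ler_wpM2l// sE; move: k2; rewrite sE; lra.
  rewrite e; lra.
have h : s Z `^ p <= Num.sqrt (2 * kappa) `^ p.
  apply: ge0_ler_powR; rewrite ?nnegrE ?sqrtr_ge0//.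
  by rewrite -[s Z]ger0_norm// -sqrtr_sqr ler_sqrt ?(ltW k2)// mulr_ge0.
have := mulr_ge0 c0 (sqr_ge0 (frob Z)); have := powR_ge0 (s Z) p; lra.
Qed.

Let young_s Z : M * s Z `^ (p - 1) <= 4^-1 * s Z `^ p + M * (4 * M) `^ (p - 1).
Proof.
have p0 := powR_ge0 (s Z) (p - 1).
have [sM|sM] := leP (4 * M) (s Z).
  have : 0 <= M * (4 * M) `^ (p - 1) by rewrite mulr_ge0 ?powR_ge0.
  rewrite -s_pow2; nra.
have : s Z `^ (p - 1) <= (4 * M) `^ (p - 1).
  by apply: ge0_ler_powR; rewrite ?nnegrE ?(ltW sM)//; rewrite mulr_ge0.
have := powR_ge0 (s Z) p.
by move=> ? h; have := ler_wpM2l hM h; lra.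
Qed.

(** With Z = A + B, the product with A is the one with Z, of order s^p, minus the
one with B, of order M s^(p-1), which Young's inequality absorbs. *)
Lemma stress_coercive : exists c C : R, [/\ 0 < c, 0 <= C & forall A B,
  frob B <= M -> c * frob A `^ p - C <= mxdot (stress p kappa (A + B)) A].
Proof.
pose C1 := Num.sqrt (2 * kappa) `^ p + M * (4 * M) `^ (p - 1).
have C10 : 0 <= C1 by rewrite addr_ge0 ?mulr_ge0 ?powR_ge0.
have t0 : 0 < 2 `^ p :> R by rewrite powR_gt0.
exists (4^-1 / 2 `^ p), (4^-1 * M `^ p + C1); split.
- by rewrite divr_gt0.
- by rewrite addr_ge0// mulr_ge0 ?powR_ge0.
move=> A B BM; set Z := A + B.
have AE : A = Z - B by rewrite /Z addrK.
have hA : frob A `^ p <= 2 `^ p * (s Z `^ p + M `^ p).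
  apply: le_trans (powRD_le _ _ _); rewrite ?s_ge0//.
  apply: ge0_ler_powR; rewrite ?nnegrE ?frob_ge0 ?addr_ge0//.
  by rewrite {1}AE (le_trans (ler_frobD _ _))// frobN lerD// frob_le_s.
have h1 : s Z `^ (p - 2) * mxdot Z B <= M * s Z `^ (p - 1).
  apply: (@le_trans _ _ (s Z `^ (p - 2) * (frob Z * M))).
    by rewrite ler_wpM2l ?powR_ge0// (le_trans (mxdot_le _ _))// ler_wpM2l ?frob_ge0.
  by rewrite mulrA mulrC ler_wpM2l// coef_frob_le.
have -> : mxdot (stress p kappa Z) A =
    s Z `^ (p - 2) * frob Z ^+ 2 - s Z `^ (p - 2) * mxdot Z B.
  by rewrite stressE [X in mxdot _ X]AE mxdotZl mxdotDr mxdotNr mxdotxx mulrBr.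
have h2 := coef_frob2_ge Z; have h3 := young_s Z.
have h4 : 4^-1 / 2 `^ p * frob A `^ p <= 4^-1 * (s Z `^ p + M `^ p).
  by rewrite -mulrA ler_wpM2l ?invr_ge0// mulrC ler_pdivrMr// mulrC.
rewrite /C1; lra.
Qed.

(** This bound makes the dissipation integrable. *)
Lemma stress_growth : exists2 C : R, 0 <= C & forall A B,
  frob B <= M -> `|mxdot (stress p kappa (A + B)) A| <= C * (1 + frob A `^ p).
Proof.
pose K := Num.sqrt kappa + M.
have K0 : 0 <= K by rewrite addr_ge0 ?sqrtr_ge0.
have t0 : 0 < 2 `^ p :> R by rewrite powR_gt0.
have Kp : 0 <= K `^ p := powR_ge0 _ _.
exists (2 `^ p * (1 + K `^ p)) => [|A B BM]; first by rewrite mulr_ge0 ?addr_ge0// ltW.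
set Z := A + B; have A0 := frob_ge0 A; have Ap := powR_ge0 (frob A) p.
have sw : s Z <= frob A + K.
  have := s_le Z; have := ler_frobD A B; rewrite -/Z /K; lra.
rewrite stressE mxdotZl normrM (ger0_norm (powR_ge0 _ _)).
apply: (@le_trans _ _ (s Z `^ (p - 1) * (frob A + K))).
  apply: (@le_trans _ _ (s Z `^ (p - 2) * frob Z * frob A)).
    by rewrite -mulrA ler_wpM2l ?powR_ge0// norm_mxdot_le.
  by rewrite ler_pM ?mulr_ge0 ?powR_ge0 ?frob_ge0 ?coef_frob_le ?lerDl.
apply: (@le_trans _ _ ((frob A + K) `^ p)).
  have -> : (frob A + K) `^ p = (frob A + K) `^ (p - 1) * (frob A + K).
    rewrite -[X in _ * X]powRr1 ?addr_ge0// -powRD; first by congr (_ `^ _); ring.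
    by rewrite gt_eqF //; have := hp; lra.
  by rewrite ler_wpM2r ?addr_ge0//; apply: ge0_ler_powR => //; rewrite nnegrE ?addr_ge0.
apply: (le_trans (powRD_le _ _ _)) => //.
by rewrite -mulrA ler_wpM2l ?(ltW t0)//; nra.
Qed.

Lemma measurable_stress : measurable_fun setT (fun A : 'M[R]_d => stress p kappa A).
Proof.
apply: measurable_fun_mx => i j; rewrite /stress.
under eq_fun do rewrite mxE.
apply: measurable_funM; last exact: measurable_coord.
apply: (measurableT_comp (measurable_powR _)); apply: measurable_funD => //.
by apply: measurable_funX; exact: measurable_frob.
Qed.

End stress_estimates.

(** * Fields on the domain *)

Section lebesgue_on_domain.
Context {R : realType} {d : nat} (O : polygonal_domain R d).
Notation mu := (lebO O).

(** The domain is contained in a box. *)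
Lemma lebO_lty : (mu setT < +oo)%E.
Proof.
have [M [_ HM]] := dom_bounded O.
pose B : R := `|M| + 1.
have B0 : 0 <= B by rewrite addr_ge0.
have OB x : dom O x -> `|x| <= B.
  by apply: (HM B); rewrite /B; have := ler_norm M; lra.
pose box := [set x : 'rV[R]_d | forall i,
  x 0 i \in `[(const_mx (- B) : 'rV[R]_d) 0 i, (const_mx B : 'rV[R]_d) 0 i]].
have mbox : measurable box.
  rewrite (_ : box = \bigcap_(i in [set: 'I_d])
      (fun x : 'rV[R]_d => x 0 i) @^-1` [set` `[- B, B]]); last first.
    apply/seteqP; split => [x h i _|x h i].
      by have := h i; rewrite !mxE.
    by have := h i I; rewrite !mxE.
  apply: fin_bigcap_measurable => // i _; rewrite -[X in measurable X]setTI.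
  by apply: measurable_coord.
have box_lty : (lebesgue_rV d box < +oo)%E.
  rewrite /box lebesgue_rV_box; first exact: ltry.
  by move=> i; rewrite !mxE; lra.
apply: le_lt_trans box_lty; rewrite /lebO /= /mrestr setTI.
apply: le_measure; rewrite ?inE//; first exact: open_measurable_mx (dom_open O).
move=> x Ox i; rewrite !mxE in_itv/= -ler_norml.
exact: le_trans (ler_coord_norm x i) (OB x Ox).
Qed.

Lemma lebO_fin_num : mu setT \is a fin_num.
Proof. by rewrite ge0_fin_numE ?lebO_lty. Qed.

Lemma integrable_cst (c : R) : mu.-integrable setT (EFin \o cst c).
Proof.
apply: measurable_bounded_integrable => //; first exact: lebO_lty.
by exists `|c|; split; [exact: num_real|move=> e ce x _; exact: ltW].
Qed.

Lemma Lfun_oo_bounded (f : 'rV[R]_d -> R) : f \in Lfun mu +oo%E ->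
  measurable_fun setT f /\ exists M : R, \forall x \ae mu, `|f x| <= M.
Proof.
rewrite inE => /andP[/[!inE]/= mf]; rewrite /finite_norm unlock.
case: ifPn => [_ ff|mu0 _]; split=> //.
  exact: (@ess_sup_inf.ess_supr_bounded _ _ _ mu (fun x => `|f x|)).
(* On a null domain the essential supremum says nothing, and every property
   holds almost everywhere. *)
exists 0, setT; split => //.
by apply/eqP; rewrite eq_le measure_ge0 andbT leNgt.
Qed.

Lemma ae_bounded_mx m n (F : 'rV[R]_d -> 'M[R]_(m, n)) :
  (forall i j, exists M : R, \forall x \ae mu, `|F x i j| <= M) ->
  exists2 M : R, 0 <= M & \forall x \ae mu, frob (F x) <= M.
Proof.
move=> FM.
have /choice[M MP] (ij : 'I_m * 'I_n) :
    exists M : R, \forall x \ae mu, `|F x ij.1 ij.2| <= M.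
  exact: FM.
have h : \forall x \ae mu, forall ij, `|F x ij.1 ij.2| <= M ij by exact: filter_forall.
exists (\sum_i \sum_j `|M (i, j)|).
  by do 2![apply: sumr_ge0 => ? _].
apply: filterS h => x h; apply: (le_trans (frob_le_sum _)).
apply: ler_sum => i _; apply: ler_sum => j _.
exact: le_trans (h (i, j)) (ler_norm _).
Qed.

Lemma in_Lp_Lfun m n (r : \bar R) (F : 'rV[R]_d -> 'M[R]_(m, n)) :
  in_Lp O r F -> frob \o F \in Lfun mu r.
Proof.
move=> [mF fF]; rewrite inE; apply/andP; split; rewrite inE//=.
exact: measurableT_comp measurable_frob mF.
Qed.

Lemma in_Lp_integrable m n (r : R) (F : 'rV[R]_d -> 'M[R]_(m, n)) : 1 <= r ->
  in_Lp O r%:E F -> mu.-integrable setT (EFin \o (fun x => frob (F x) `^ r)).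
Proof.
move=> r1 /in_Lp_Lfun /(Lfun_integrable r1); apply: eq_integrable => // x _ /=.
by rewrite ger0_norm ?frob_ge0.
Qed.

Lemma in_Lp_bounded m n (r M : R) (F : 'rV[R]_d -> 'M[R]_(m, n)) : 0 <= r ->
  measurable_fun setT F -> (\forall x \ae mu, frob (F x) <= M) ->
  in_Lp O r%:E F.
Proof.
move=> r0 mF FM; have mf : measurable_fun setT (frob \o F).
  exact: measurableT_comp measurable_frob mF.
split=> //; apply: integrable_powR_finite_norm => //.
apply: (ae_le_integrable (g := cst (M `^ r))).
- exact: measurable_norm_powR.
- exact: integrable_cst.
- apply: filterS FM => x FxM /=; rewrite ger0_norm ?powR_ge0//.
  rewrite ger0_norm ?frob_ge0//; apply: ge0_ler_powR; rewrite ?nnegrE ?frob_ge0//.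
  exact: le_trans (frob_ge0 _) FxM.
Qed.

Lemma normLp_powR (r : R) (f : 'rV[R]_d -> R) : 0 < r ->
  f \in Lfun mu r%:E -> normLp O r%:E f `^ r = \int[mu]_x (`|f x| `^ r).
Proof.
rewrite inE => r0 /andP[_ /[!inE]/= fr].
apply: EFin_inj; rewrite /normLp -poweR_EFin fineK; last first.
  by rewrite ge0_fin_numE ?Lnorm_ge0.
rewrite powR_Lnorm ?gt_eqF// /Rintegral fineK//.
have := poweR_lty r fr; rewrite powR_Lnorm ?gt_eqF// => h.
by rewrite ge0_fin_numE ?integral_ge0// => x _; rewrite lee_fin powR_ge0.
Qed.

Lemma in_L2_mxdot m n (F G : 'rV[R]_d -> 'M[R]_(m, n)) :
  in_Lp O 2%:E F -> in_Lp O 2%:E G ->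
  mu.-integrable setT (EFin \o (fun x => mxdot (F x) (G x))).
Proof.
move=> F2 G2.
have iF := Lfun2_integrable_sqr (in_Lp_Lfun F2).
have iG := Lfun2_integrable_sqr (in_Lp_Lfun G2).
apply: (ae_le_integrable _ (integrableD measurableT iF iG)).
  by apply: measurable_mxdot; [have [] := F2|have [] := G2].
by apply: nearW => x; exact: norm_mxdot_le_sqr.
Qed.

Lemma wgrad_bounded (z : 'rV[R]_d -> 'rV[R]_d) : vsobolev O 1 +oo%E z ->
  measurable_fun setT (wgrad O z) /\
  exists2 M : R, 0 <= M & \forall x \ae mu, frob (wgrad O z x) <= M.
Proof.
move=> hz.
have h j i : wpartial O j (coordf z i) \in Lfun mu +oo%E.
  by have [_ /(_ j)[_ []]] := hz i.
split.
  apply: measurable_fun_mx => j i; rewrite /wgrad; under eq_fun do rewrite mxE.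
  by have [] := Lfun_oo_bounded (h j i).
apply: ae_bounded_mx => j i; have [_ [M HM]] := Lfun_oo_bounded (h j i).
by exists M; apply: filterS HM => x; rewrite mxE.
Qed.

Lemma vsobolev_bounded (k : nat) (z : 'rV[R]_d -> 'rV[R]_d) : vsobolev O k +oo%E z ->
  measurable_fun setT z /\ exists2 M : R, 0 <= M & \forall x \ae mu, frob (z x) <= M.
Proof.
move=> hz.
have h i : coordf z i \in Lfun mu +oo%E by have := hz i; case: k {hz} => [|k] [].
split.
  apply: measurable_fun_mx => j i; rewrite ord1.
  by have [] := Lfun_oo_bounded (h i).
apply: ae_bounded_mx => j i; rewrite ord1; have [_ [M HM]] := Lfun_oo_bounded (h i).
by exists M.
Qed.

Lemma sobolevW (k : nat) (r : \bar R) (f : 'rV[R]_d -> R) :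
  sobolev O k.+1 r f -> sobolev O k r f.
Proof.
elim: k f => [|k IH] f; first by move=> [].
move=> [fr h]; split=> // i; have [w hi] := h i; split=> //; exact: IH.
Qed.

End lebesgue_on_domain.

Section linear_fields.
Context {R : realType} {d : nat} (O : polygonal_domain R d).
Context {V W : lmodType R} (f : V -> 'rV[R]_d -> W).
Hypothesis lin_f : linear_ae O f.

Lemma linear_ae0 : \forall x \ae lebO O, f 0 x = 0.
Proof.
apply: filterS (lin_f 1 0 0) => x; rewrite !scale1r addr0 => /eqP.
by rewrite -subr_eq0 opprD addNKr oppr_eq0 => /eqP.
Qed.

Lemma linear_aeD u v : \forall x \ae lebO O, f (u + v) x = f u x + f v x.
Proof. by apply: filterS (lin_f 1 u v) => x; rewrite !scale1r. Qed.

Lemma linear_aeZ a u : \forall x \ae lebO O, f (a *: u) x = a *: f u x.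
Proof.
by apply: filterS2 linear_ae0 (lin_f a u 0) => x f0; rewrite addr0 f0 addr0.
Qed.

End linear_fields.

(** * The energy balance of one time step *)

Lemma young_absorb (R : realType) (p K e : R) : 1 < p -> 0 <= K -> 0 < e ->
  exists2 C : R, 0 <= C & forall x y, 0 <= x -> 0 <= y ->
    K * x * y <= e * x `^ p + C * y `^ conj_exp p.
Proof.
move=> p1 K0 e0; pose q := conj_exp p.
have p0 : 0 < p := lt_trans ltr01 p1.
have p10 : 0 < p - 1 by rewrite subr_gt0.
have q0 : 0 < q by rewrite divr_gt0.
have pq : p^-1 + q^-1 = 1.
  by rewrite /q /conj_exp; field; rewrite !gt_eqF.
(* With this weight the first term of Young's inequality is exactly e x^p. *)
pose th := (p * e) `^ p^-1.
have th0 : 0 < th by rewrite powR_gt0// mulr_gt0.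
exists ((K / th) `^ q / q); first by rewrite divr_ge0 ?powR_ge0 ?(ltW q0).
move=> x y x0 y0.
have a0 : 0 <= th * x by rewrite mulr_ge0// ltW.
have kt : 0 <= K / th by rewrite divr_ge0// ltW.
have b0 : 0 <= K / th * y by rewrite mulr_ge0.
have := conjugate_powR a0 b0 p0 q0 pq.
rewrite powRM ?(ltW th0)// powRM// /th -powRrM mulVf ?gt_eqF// powRr1 ?mulr_ge0 ?(ltW p0) ?(ltW e0)//.
rewrite -/th (_ : th * x * (K / th * y) = K * x * y); last by field; rewrite gt_eqF.
rewrite (_ : p * e * x `^ p / p = e * x `^ p); last by field; rewrite gt_eqF.
by rewrite [(K / th) `^ q * _ / q]mulrAC.
Qed.

Lemma le1D_powR (R : realType) (x p : R) : 0 <= x -> 1 <= p -> x <= 1 + x `^ p.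
Proof.
move=> x0 p1; have [x1|x1] := leP x 1.
  by rewrite (le_trans x1)// lerDl powR_ge0.
have : x `^ 1 <= x `^ p by apply: ler_powR => //; exact: ltW.
by rewrite powRr1// => h; lra.
Qed.

Section energy.
Context {R : realType} {d : nat} (O : polygonal_domain R d) {X Y : vectType R}.
Variables (D : gd_data d X Y) (p : R).
Hypotheses (hp : 1 < p) (hD : is_gd O D p).
Notation mu := (lebO O).
Notation Pi := (gd_Pi D).
Notation eps := (gd_eps D).

Let p_ge1 : 1 <= p. Proof. exact: ltW. Qed.
Let p_gt0 : 0 < p. Proof. exact: lt_trans ltr01 hp. Qed.

Let measurable_Pi v : measurable_fun setT (Pi v).
Proof. by have [] := gd_Pi_L2 hD v. Qed.

Let eps_Lp v : in_Lp O p%:E (eps v).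
Proof. by have [] := gd_Lp hD (or_introl erefl) v. Qed.

Let measurable_eps v : measurable_fun setT (eps v).
Proof. by have [] := eps_Lp v. Qed.

Lemma pairing_PiD F u v : in_Lp O 2%:E F ->
  pairing_mx O F (Pi (u + v)) = pairing_mx O F (Pi u) + pairing_mx O F (Pi v).
Proof.
move=> F2; have mF : measurable_fun setT F by have [] := F2.
have int w := in_L2_mxdot F2 (gd_Pi_L2 hD w).
rewrite /pairing_mx -RintegralD//; apply: ae_eq_Rintegral.
- exact: measurable_mxdot.
- by apply: measurable_funD; exact: measurable_mxdot.
- by apply: filterS (linear_aeD (gd_Pi_lin hD) u v) => x ->; rewrite mxdotDr.
Qed.

Lemma pairing_PiZ F a u : in_Lp O 2%:E F ->
  pairing_mx O F (Pi (a *: u)) = a * pairing_mx O F (Pi u).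
Proof.
move=> F2; have mF : measurable_fun setT F by have [] := F2.
have int w := in_L2_mxdot F2 (gd_Pi_L2 hD w).
rewrite /pairing_mx -RintegralZl//; apply: ae_eq_Rintegral.
- exact: measurable_mxdot.
- by apply: measurable_funM => //; exact: measurable_mxdot.
- by apply: filterS (linear_aeZ (gd_Pi_lin hD) a u) => x ->; rewrite mxdotZr.
Qed.

Lemma pairing_Pi_le_coord F : in_Lp O 2%:E F ->
  exists2 C : R, 0 <= C & forall v, `|pairing_mx O F (Pi v)| <= C * `|v2r v|.
Proof.
move=> F2; apply: seminorm_le_coord => [u v|a u].
  by rewrite pairing_PiD// ler_normD.
by rewrite pairing_PiZ// normrM.
Qed.

Definition kinetic (v : X) : R := pairing_mx O (Pi v) (Pi v).

Lemma kinetic_ge0 v : 0 <= kinetic v.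
Proof. by apply: Rintegral_ge0 => x _; rewrite mxdotxx sqr_ge0. Qed.

Lemma pairing_mxC m n (F G : 'rV[R]_d -> 'M[R]_(m, n)) :
  pairing_mx O F G = pairing_mx O G F.
Proof. by apply: eq_Rintegral => x _; rewrite mxdotC. Qed.

(** The kinetic energy is a quadratic form: expand one argument on the canonical
basis and bound each functional of the other argument. *)
Lemma kinetic_le_coord : exists2 C : R, 0 <= C &
  forall v, kinetic v <= C * `|v2r v| ^+ 2.
Proof.
have L2 v := gd_Pi_L2 hD v.
pose e i : X := r2v (delta_mx 0 i).
have [C C0 hC] : exists2 C : R, 0 <= C &
    forall v, \sum_i `|pairing_mx O (Pi (e i)) (Pi v)| <= C * `|v2r v|.
  apply: (@seminorm_le_coord _ _
    (fun v => \sum_i `|pairing_mx O (Pi (e i)) (Pi v)|)) => [u v|a u].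
    rewrite -big_split; apply: ler_sum => i _.
    by rewrite pairing_PiD// ler_normD.
  by rewrite mulr_sumr; apply: eq_bigr => i _; rewrite pairing_PiZ// normrM.
exists C => // v; rewrite expr2 mulrA mulrC.
apply: (@le_trans _ _ (`|v2r v| * \sum_i `|pairing_mx O (Pi (e i)) (Pi v)|)); last first.
  by rewrite ler_wpM2l.
have -> : kinetic v = \sum_i (v2r v) 0 i * pairing_mx O (Pi v) (Pi (e i)).
  have vE : v = \sum_i (v2r v) 0 i *: e i.
    rewrite -[LHS](v2rK v) [in LHS](row_sum_delta (v2r v)) linear_sum/=.
    by apply: eq_bigr => i _; rewrite linearZ.
  rewrite /kinetic {2}vE.
  rewrite (big_morph (fun w => pairing_mx O (Pi v) (Pi w)) (id1 := 0) (op1 := +%R)).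
  - by apply: eq_bigr => i _; rewrite pairing_PiZ.
  - by move=> u w; rewrite pairing_PiD.
  - by rewrite -(scale0r (0 : X)) pairing_PiZ// mul0r.
rewrite mulr_sumr; apply: ler_sum => i _; rewrite pairing_mxC.
by apply: (le_trans (ler_norm _)); rewrite normrM ler_wpM2r// ler_coord_norm.
Qed.

(** The product of a difference with the corresponding mean is half the
difference of squares. *)
Lemma pairing_increment v v1 :
  pairing_mx O (fun x => Pi v1 x - Pi v x) (Pi (mid v v1)) =
  2^-1 * (kinetic v1 - kinetic v).
Proof.
have L2 w := gd_Pi_L2 hD w.
rewrite /kinetic /pairing_mx -RintegralB//; [|exact: in_L2_mxdot..].
rewrite -RintegralZl//; last first.
  exact: (integrableB measurableT (in_L2_mxdot (L2 v1) (L2 v1))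
    (in_L2_mxdot (L2 v) (L2 v))).
have mB : measurable_fun setT (fun x => Pi v1 x - Pi v x).
  apply: measurable_fun_mx => i j; under eq_fun do rewrite !mxE.
  by apply: measurable_funB; apply: (measurableT_comp (measurable_coord _ _)).
apply: ae_eq_Rintegral.
- exact: measurable_mxdot.
- apply: measurable_funM => //; apply: measurable_funB; exact: measurable_mxdot.
- apply: filterS2 (linear_aeZ (gd_Pi_lin hD) 2^-1 (v1 + v))
    (linear_aeD (gd_Pi_lin hD) v1 v) => x h1 h2.
  rewrite /mid h1 h2 mxdotZr mxdotDl !mxdotDr !mxdotNl (mxdotC (Pi v x) (Pi v1 x)).
  by congr (_ * _); ring.
Qed.

Lemma norm_eps_powR v :
  norm_eps O D p v `^ p = \int[mu]_x (frob (eps v x) `^ p).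
Proof.
rewrite /norm_eps normLp_powR//; last exact: in_Lp_Lfun.
by apply: eq_Rintegral => x _ /=; rewrite ger0_norm ?frob_ge0.
Qed.

Lemma Y0B q q1 : Y0 O D q -> Y0 O D q1 -> Y0 O D (q1 - q).
Proof.
move=> Yq Yq1.
have r1 : 1 <= Num.min p (conj_exp p).
  rewrite le_min p_ge1 /= /conj_exp ler_pdivlMr ?subr_gt0// mul1r.
  by rewrite gerBl.
have int q' : mu.-integrable setT (EFin \o gd_chi D q').
  apply/Lfun1_integrable/(Lfun_subset _ _ (lebO_fin_num O) _ (gd_chi_Lp hD q')) => //.
have -> : q1 - q = -1 *: q + q1 by rewrite scaleN1r addrC.
rewrite /Y0 /= (@ae_eq_Rintegral _ _ _ _ _ (fun x => gd_chi D q1 x - gd_chi D q x)).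
- by rewrite RintegralB// Yq Yq1 subr0.
- exact: measurable_integrable.
- by apply: measurable_funB; exact: measurable_integrable.
- apply: filterS (gd_chi_lin hD (-1) q q1) => x ->.
  by rewrite addrC /GRing.scale /= mulN1r.
Qed.

(** The pressure increment is an admissible test function for the
discrete divergence constraint. *)
Lemma pairing_pressure0 q q1 v : Y0 O D q -> Y0 O D q1 ->
  (forall q', Y0 O D q' -> pairing O (gd_div D v) (gd_chi D q') = 0) ->
  pairing O (fun x => gd_chi D q1 x - gd_chi D q x) (gd_div D v) = 0.
Proof.
move=> Yq Yq1 /(_ _ (Y0B Yq Yq1)) <-.
have mchi q' : measurable_fun setT (gd_chi D q').
  by have := gd_chi_Lp hD q'; rewrite inE => /andP[/[!inE]].
have mdiv : measurable_fun setT (gd_div D v).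
  by have [_ _ _] := gd_Lp hD (or_introl erefl) v; rewrite inE => /andP[/[!inE]].
apply: ae_eq_Rintegral.
- by apply: measurable_funM => //; exact: measurable_funB.
- exact: measurable_funM.
- have -> : q1 - q = -1 *: q + q1 by rewrite scaleN1r addrC.
  apply: filterS (gd_chi_lin hD (-1) q q1) => x ->.
  by rewrite mulrC addrC /GRing.scale /= mulN1r.
Qed.

End energy.

Section energy_inequality.
Context {R : realType} {d : nat} (O : polygonal_domain R d) {X Y : vectType R}.
Variables (D : gd_data d X Y) (p kappa tau : R).
Hypotheses (hp : 1 < p) (hD : is_gd O D p) (hkappa : 0 <= kappa) (htau : 0 < tau).
Variables (g sigma : 'rV[R]_d -> 'rV[R]_d).
Hypotheses (hg : vsobolev O 1 +oo%E g) (hsigma : vsobolev O 1 +oo%E sigma).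
Notation mu := (lebO O).
Notation Pi := (gd_Pi D).
Notation eps := (gd_eps D).
Notation kinetic := (kinetic O D).

Let p_ge1 : 1 <= p. Proof. exact: ltW. Qed.
Let p_gt0 : 0 < p. Proof. exact: lt_trans ltr01 hp. Qed.

Let eps_Lp v : in_Lp O p%:E (eps v).
Proof. by have [] := gd_Lp hD (or_introl erefl) v. Qed.

Let int_eps v := in_Lp_integrable p_ge1 (eps_Lp v).

Lemma wsymgrad_bounded : measurable_fun setT (wsymgrad O g) /\
  exists2 M : R, 0 <= M & \forall x \ae mu, frob (wsymgrad O g x) <= M.
Proof.
have [mG [M M0 HM]] := wgrad_bounded hg.
have wsymE x i j : wsymgrad O g x i j = 2^-1 * (wgrad O g x i j + wgrad O g x j i).
  by rewrite /wsymgrad; set W := wgrad O g x; rewrite !mxE.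
have mGij i j : measurable_fun setT (fun x => wgrad O g x i j).
  exact: (measurableT_comp (measurable_coord _ _)).
split.
  apply: measurable_fun_mx => i j; under eq_fun do rewrite wsymE.
  by apply: measurable_funM => //; exact: measurable_funD.
apply: ae_bounded_mx => i j; exists M; apply: filterS HM => x Mx.
rewrite wsymE normrM gtr0_norm ?invr_gt0//.
have h1 := le_trans (norm_coord_le_frob (wgrad O g x) i j) Mx.
have h2 := le_trans (norm_coord_le_frob (wgrad O g x) j i) Mx.
have := ler_normD (wgrad O g x i j) (wgrad O g x j i); lra.
Qed.

Lemma transport_L2 : in_Lp O 2%:E (fun x => sigma x *m wgrad O g x).
Proof.
have [mG [M M0 HM]] := wgrad_bounded hg.
have [ms [N N0 HN]] := vsobolev_bounded hsigma.
have [K K0 HK] : exists2 K : R, 0 <= K &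
    \forall x \ae mu, frob (sigma x *m wgrad O g x) <= K.
  apply: ae_bounded_mx => i j; exists (\sum_(k < d) N * M).
  apply: filterS2 HM HN => x Mx Nx; rewrite mxE.
  apply: (le_trans (ler_norm_sum _ _ _)); apply: ler_sum => k _.
  rewrite normrM ler_pM//; first exact: le_trans (norm_coord_le_frob _ _ _) Nx.
  exact: le_trans (norm_coord_le_frob _ _ _) Mx.
apply: in_Lp_bounded HK => //.
apply: measurable_fun_mx => i j; under eq_fun do rewrite mxE.
by apply: measurable_sum => k; apply: measurable_funM;
  apply: (measurableT_comp (measurable_coord _ _)).
Qed.

(** Integrate the pointwise coercivity; the p-norm of the discrete symmetric
gradient is a norm on X, hence bounds the coordinates. *)
Lemma dissipation_coercive : exists c C : R, [/\ 0 < c, 0 <= C & forall v,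
  c * `|v2r v| `^ p - C <=
  pairing_mx O (fun x => stress p kappa (eps v x + wsymgrad O g x)) (eps v)].
Proof.
have [mB [M M0 HM]] := wsymgrad_bounded.
have [c1 [C1 [c10 C10 h1]]] := @stress_coercive R d p kappa M hp hkappa M0.
have [C2 C20 h2] := @stress_growth R d p kappa M hp hkappa M0.
have [N_tri N_scale N_eq0] := gd_eps_norm hD.
have [c c0 hc] := norm_ge_coord (fun u v => N_tri u v I I)
  (fun a u => N_scale a u I) (fun u => N_eq0 u I).
exists (c1 * c `^ p), (C1 * fine (mu setT)); split => [||v].
- by rewrite mulr_gt0// powR_gt0.
- by rewrite mulr_ge0// fine_ge0.
have mE : measurable_fun setT (eps v) by have [] := eps_Lp v.
have ie := int_eps v.
have ilow : mu.-integrable setT (EFin \o (fun x => c1 * frob (eps v x) `^ p - C1)).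
  exact: (integrableB measurableT (integrableZl measurableT c1 ie) (integrable_cst O C1)).
have iup : mu.-integrable setT (EFin \o (fun x => C2 * (1 + frob (eps v x) `^ p))).
  exact: (integrableZl measurableT C2 (integrableD measurableT (integrable_cst O 1) ie)).
have mS : measurable_fun setT
    (fun x => mxdot (stress p kappa (eps v x + wsymgrad O g x)) (eps v x)).
  apply: measurable_mxdot => //.
  apply: (measurableT_comp (measurable_stress p kappa)).
  apply: measurable_fun_mx => i j; under eq_fun do rewrite mxE.
  by apply: measurable_funD; apply: (measurableT_comp (measurable_coord _ _)).
have iS : mu.-integrable setT
    (EFin \o fun x => mxdot (stress p kappa (eps v x + wsymgrad O g x)) (eps v x)).
  by apply: (ae_le_integrable mS iup); apply: filterS HM => x; exact: h2.
apply: (@le_trans _ _ (\int[mu]_x (c1 * frob (eps v x) `^ p - C1))).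
  rewrite RintegralB//; [|exact: (integrableZl measurableT c1 ie)|exact: integrable_cst].
  rewrite RintegralZl// Rintegral_cst// lerD2r -norm_eps_powR// -mulrA ler_wpM2l ?(ltW c10)//.
  have cv0 : 0 <= c * `|v2r v| := mulr_ge0 (ltW c0) (normr_ge0 _).
  rewrite -powRM ?(ltW c0)//.
  apply: (ge0_ler_powR (ltW p_gt0) _ _ (hc v)); rewrite nnegrE//.
  exact: le_trans (hc v).
by apply: ae_le_Rintegral => //; apply: filterS HM => x; exact: h1.
Qed.

Lemma noise_form_diag v : noise_form O D sigma v v = 0.
Proof. by rewrite /noise_form [X in _ - _ * X]pairing_mxC subrr. Qed.

(** The balance of one step, tested with the midpoint.  Bounding x by 1 + x^p
keeps only the first power of the norm of the midpoint, which is all that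
tightness requires. *)
Lemma time_step_energy : exists c C : R, [/\ 0 < c, 0 <= C &
  forall dW v q v1 q1, Y0 O D q -> time_step O D p kappa tau g sigma dW v q v1 q1 ->
  kinetic v1 + c * `|v2r (mid v v1)| <= kinetic v + C * (1 + `|dW| `^ conj_exp p)].
Proof.
have [c1 [C1 [c10 C10 hdiss]]] := dissipation_coercive.
have [K K0 hK] := pairing_Pi_le_coord hD transport_L2.
have e0 : 0 < tau * c1 / 2 by rewrite divr_gt0// mulr_gt0.
have [C2 C20 hyoung] := young_absorb hp K0 e0.
have tc0 : 0 < tau * c1 by rewrite mulr_gt0.
have tC0 : 0 <= tau * C1 by rewrite mulr_ge0// ltW.
exists (tau * c1), (tau * c1 + 2 * (tau * C1) + 2 * C2); split => //.
  by rewrite !addr_ge0// ?mulr_ge0// ltW.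
move=> dW v q v1 q1 Yq [Yq1 hstep hdiv].
have := hstep (mid v v1).
rewrite (pairing_increment hD) (pairing_pressure0 hp hD Yq Yq1 hdiv).
rewrite noise_form_diag add0r subr0.
have := hdiss (mid v v1); have := hK (mid v v1).
set a := pairing_mx O (fun x => stress _ _ _) _; set L := pairing_mx O _ _.
set x := `|v2r (mid v v1)| => hL ha hE.
have x0 : 0 <= x by exact: normr_ge0.
have y0 := normr_ge0 dW.
have hLW : L * dW <= K * x * `|dW|.
  by rewrite (le_trans (ler_norm _))// normrM ler_wpM2r.
have hY := hyoung x `|dW| x0 y0.
have hx := le1D_powR x0 p_ge1.
have W0 : 0 <= `|dW| `^ conj_exp p := powR_ge0 _ _.
have ta : tau * (c1 * x `^ p - C1) <= tau * a by rewrite ler_wpM2l// ltW.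
have tx : tau * c1 * x <= tau * c1 * (1 + x `^ p) by rewrite ler_wpM2l// ltW.
rewrite !mulrDl !mulrDr in ta tx *.
have w1 : 0 <= tau * c1 * `|dW| `^ conj_exp p by rewrite mulr_ge0// ltW.
have w2 : 0 <= tau * C1 * `|dW| `^ conj_exp p by rewrite mulr_ge0.
nra.
Qed.

Lemma init_step_energy (vin : L2 O) v q : init_step D vin v q ->
  kinetic v <= pairing_mx O (L2rep vin) (L2rep vin).
Proof.
move=> [Yq hstep hdiv].
have vin2 : in_Lp O 2%:E (L2rep vin) by apply/asboolP; exact: L2valP.
have v2 := gd_Pi_L2 hD v.
have := hstep v; rewrite (_ : pairing O (gd_chi D q) (gd_div D v) = 0); last first.
  rewrite -(hdiv _ Yq); apply: eq_Rintegral => x _; exact: mulrC.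
rewrite addr0 => hk.
have : pairing_mx O (L2rep vin) (Pi v) <=
    2^-1 * (pairing_mx O (L2rep vin) (L2rep vin) + kinetic v).
  rewrite /kinetic /pairing_mx -RintegralD//; [|exact: in_L2_mxdot..].
  rewrite -RintegralZl//; last first.
    exact: (integrableD measurableT (in_L2_mxdot vin2 vin2) (in_L2_mxdot v2 v2)).
  apply: le_Rintegral => //.
  - exact: in_L2_mxdot.
  - exact: (integrableZl measurableT 2^-1 (integrableD measurableT
      (in_L2_mxdot vin2 vin2) (in_L2_mxdot v2 v2))).
  - move=> x _; rewrite !mxdotxx; have := mxdot_le (L2rep vin x) (Pi v x).
    have := sqr_ge0 (frob (L2rep vin x) - frob (Pi v x)); nra.
by rewrite -hk -/(kinetic v); lra.
Qed.

End energy_inequality.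

(** * Averaged laws and reconstruction *)

Section averaged_laws.
Context d d' (T : measurableType d) (T' : measurableType d') (R : realType).
Variables (P : probability T R) (X : nat -> {mfun T >-> T'}) (N : nat).

Definition avg_law : set T' -> \bar R :=
  mscale (N.+1%:R^-1)%:nng (msum (fun n => distribution P (X n)) N.+1).

HB.instance Definition _ := Measure.on avg_law.

Lemma avg_lawE A :
  avg_law A = (N.+1%:R^-1%:E * \sum_(n < N.+1) P (X n @^-1` A))%E.
Proof. by []. Qed.

Let avg_law_setT : avg_law setT = 1%E.
Proof.
rewrite avg_lawE; under eq_bigr do rewrite preimage_setT probability_setT.
by rewrite sumEFin sumr_const card_ord -EFinM -[_ *+ _]mulr_natr mul1r mulVf.
Qed.

HB.instance Definition _ :=
  Measure_isProbability.Build _ _ _ avg_law avg_law_setT.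

End averaged_laws.

Section reconstruction.
Context {R : realType} {d : nat} (O : polygonal_domain R d).
Notation mu := (lebO O).

Lemma L2rep_L2 (u : L2 O) : in_Lp O 2%:E (L2rep u).
Proof. by apply/asboolP; exact: L2valP. Qed.

Lemma L2rep_toL2 F : in_Lp O 2%:E F -> \forall x \ae mu, L2rep (toL2 O F) x = F x.
Proof.
move=> F2; have F2b : `[< in_Lp O 2%:E F >] by apply/asboolP.
have /eqmodP/asboolP := reprK (toL2 O F).
by rewrite /toL2 insubdK.
Qed.

Context {X Y : vectType R} (D : gd_data d X Y) (p : R) (hD : is_gd O D p).

Definition reconstruct (x : 'rV[R]_(dim X)) : L2 O := toL2 O (gd_Pi D (r2v x)).

Lemma L2dist_reconstruct x y :
  L2dist (reconstruct x) (reconstruct y) ^+ 2 = kinetic O D (r2v (x - y)).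
Proof.
have L2v v := gd_Pi_L2 hD v.
have mR (u : L2 O) : measurable_fun setT (L2rep u) by have [] := L2rep_L2 u.
have mB : measurable_fun setT
    (fun z => L2rep (reconstruct x) z - L2rep (reconstruct y) z).
  apply: measurable_fun_mx => i j; under eq_fun do rewrite !mxE.
  by apply: measurable_funB; apply: (measurableT_comp (measurable_coord _ _)).
have mPi v : measurable_fun setT (gd_Pi D v) by have [] := L2v v.
have ae_eq : \forall z \ae mu, L2rep (reconstruct x) z - L2rep (reconstruct y) z =
    gd_Pi D (r2v (x - y)) z.
  apply: filterS3 (L2rep_toL2 (L2v (r2v x))) (L2rep_toL2 (L2v (r2v y)))
    (gd_Pi_lin hD (-1) (r2v y) (r2v x)) => z h1 h2 h3.
  rewrite /reconstruct h1 h2 (_ : r2v (x - y) = -1 *: r2v y + r2v x).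
    by rewrite h3 scaleN1r addrC.
  by rewrite linearB scaleN1r addrC.
have B2 : in_Lp O 2%:E (fun z => L2rep (reconstruct x) z - L2rep (reconstruct y) z).
  split=> //; have mf := measurableT_comp measurable_frob mB.
  apply: integrable_powR_finite_norm => //.
  apply: (ae_le_integrable _ (in_Lp_integrable _ (L2v (r2v (x - y))))).
  - exact: measurable_norm_powR.
  - by rewrite ler1n.
  - by apply: filterS ae_eq => z /= ->; rewrite !ger0_norm ?powR_ge0 ?frob_ge0.
rewrite -powR_mulrn ?fine_ge0 ?Lnorm_ge0// /L2dist normLp_powR//; last exact: in_Lp_Lfun B2.
apply: ae_eq_Rintegral.
- by apply: measurable_norm_powR; exact: (measurableT_comp measurable_frob mB).
- exact: measurable_mxdot.
- apply: filterS ae_eq => z ->; rewrite mxdotxx ger0_norm ?frob_ge0//.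
  by rewrite powR_mulrn ?frob_ge0.
Qed.

(** The reconstruction is linear up to null sets, so distances between images are
square roots of kinetic energies and the map is Lipschitz. *)
Lemma continuous_reconstruct : continuous reconstruct.
Proof.
have [C C0 hC] := kinetic_le_coord hD.
move=> x A /nbhs_ballP[e /= e0 eA]; apply/nbhs_ballP.
pose K := Num.sqrt (C + 1).
have K0 : 0 < K by rewrite sqrtr_gt0 ltr_wpDl.
exists (e / K) => /=; first by rewrite divr_gt0.
move=> y; rewrite -ball_normE /= => xy; apply: eA; rewrite ballEmdist /=.
suff : L2dist (reconstruct x) (reconstruct y) < e by [].
have L0 : 0 <= L2dist (reconstruct x) (reconstruct y) by rewrite fine_ge0// Lnorm_ge0.
apply: (@le_lt_trans _ _ (K * `|x - y|)); last by rewrite mulrC -ltr_pdivlMr.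
rewrite -(@ler_pXn2r _ 2)// ?nnegrE//; last by rewrite mulr_ge0// ltW.
rewrite L2dist_reconstruct (le_trans (hC _))// r2vK exprMn sqr_sqrtr ?addr_ge0//.
by rewrite ler_wpM2r ?sqr_ge0// lerDl.
Qed.

Lemma measurable_reconstruct : measurable_fun setT reconstruct.
Proof.
apply: (measurability (@open (L2 O)) erefl) => _ [B oB <-]; rewrite setTI.
by apply: open_measurable_mx; apply: open_comp => // x _; exact: continuous_reconstruct.
Qed.

Lemma measurable_continuous_L2 (f : L2 O -> R) : continuous f -> measurable_fun setT f.
Proof.
move=> cf; apply: borel_measurable_real => B oB; apply: sub_sigma_algebra.
by apply: open_comp => // x _; exact: cf.
Qed.

End reconstruction.

Section wiener_increments.
Context {dsp : measure_display} {Omega : measurableType dsp} {R : realType}.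
Variables (P : probability Omega R) (F : R -> set (set Omega)) (W : R -> Omega -> R).
Hypotheses (hF : usual_filtration P F) (hW : wiener P F W).

Lemma measurable_wiener t : 0 <= t -> measurable_fun setT (W t).
Proof.
move=> t0 _ B mB; apply: (filt_sub hF t0); apply: (wiener_adapted hW t0).
by exists B.
Qed.

(** Stationarity of the increments makes this moment independent of s. *)
Lemma wiener_increment_moment (s h q : R) : 0 <= s -> 0 < h ->
  (\int[P]_w (`|W (s + h) w - W s w| `^ q)%:E =
   \int[normal_prob 0 (Num.sqrt h)]_y (`|y| `^ q)%:E)%E.
Proof.
move=> s0 h0.
have mW : measurable_fun setT (fun w => W (s + h) w - W s w).
  by apply: measurable_funB; apply: measurable_wiener => //; rewrite addr_ge0// ltW.
(* The Gaussian law is a measure on this copy of the real line. *)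
pose Y := measurableTypeR R.
have mWY : @measurable_fun _ _ Omega Y setT (fun w => W (s + h) w - W s w) := mW.
have mq : @measurable_fun _ _ Y _ setT (fun y : R => (`|y| `^ q)%:E).
  by apply/measurable_EFinP; exact: (@measurable_norm_powR _ _ _ (id : Y -> R)).
pose m1 := measure_function_pushforward__canonical__measure_function_Measure P mWY.
transitivity (\int[m1]_y (`|y| `^ q)%:E)%E.
  by rewrite (@ge0_integral_pushforward _ _ Omega Y R _ mWY)// => y _; rewrite lee_fin powR_ge0.
apply: eq_measure_integral => A mA _.
have := wiener_gauss hW s0 (_ : s < s + h) mA; rewrite ltrDl h0 => /(_ isT).
by rewrite addrAC subrr add0r; exact.
Qed.

End wiener_increments.

(** * Tightness of the averaged laws *)

Lemma Rintegral_sum_ord d (T : measurableType d) (R : realType)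
    (mu : {measure set T -> \bar R}) (N : nat) (f : nat -> T -> R) :
  (forall n, mu.-integrable setT (EFin \o f n)) ->
  mu.-integrable setT (EFin \o (fun x => \sum_(n < N) f n x)) /\
  \int[mu]_x (\sum_(n < N) f n x) = \sum_(n < N) \int[mu]_x f n x.
Proof.
move=> intf; elim: N => [|N [IH1 IH2]].
  rewrite big_ord0 (_ : (fun x => _) = cst 0); last first.
    by apply/funext => x; rewrite big_ord0.
  split; first exact: integrable0.
  by rewrite Rintegral_cst// mul0r.
have -> : (fun x => \sum_(n < N.+1) f n x) =
    (fun x => \sum_(n < N) f n x + f N x).
  by apply/funext => x; rewrite big_ord_recr.
split; first exact: (integrableD measurableT IH1 (intf N)).
by rewrite RintegralD// IH2 big_ord_recr.
Qed.

(** Expectation of a pathwise bound on the number of events that occur. *)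
Lemma sum_probability_le d (T : measurableType d) (R : realType)
    (P : probability T R) (A : nat -> set T) (G : nat -> T -> R) (c K C m : R) (N : nat) :
  (forall n, measurable (A n)) -> (forall n, measurable_fun setT (G n)) ->
  (forall n x, 0 <= G n x) -> (forall n, \int[P]_x (G n x)%:E = m%:E)%E ->
  (\forall x \ae P, c * \sum_(n < N) \1_(A n) x <= K + C * \sum_(n < N) (1 + G n x)) ->
  c * \sum_(n < N) fine (P (A n)) <= K + N%:R * (C * (1 + m)).
Proof.
move=> mA mG G0 intG AG.
have iA n : P.-integrable setT (EFin \o (\1_(A n) : T -> R)).
  exact: integrable_indic.
have iG n : P.-integrable setT (EFin \o G n).
  apply/integrableP; split; first exact/measurable_EFinP.
  rewrite (_ : (\int[P]_x `|(EFin \o G n) x| = m%:E)%E) ?ltry// -(intG n).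
  by apply: eq_integral => x _ /=; rewrite ger0_norm.
have i1 : P.-integrable setT (EFin \o (cst 1 : T -> R)).
  exact: finite_measure_integrable_cst.
have iK : P.-integrable setT (EFin \o (cst K : T -> R)).
  exact: finite_measure_integrable_cst.
have i1G n := integrableD measurableT i1 (iG n).
have [isA sA] := @Rintegral_sum_ord _ _ _ P N (fun n => \1_(A n)) iA.
have [isG sG] := @Rintegral_sum_ord _ _ _ P N (fun n x => 1 + G n x) i1G.
have -> : c * \sum_(n < N) fine (P (A n)) = \int[P]_x (c * \sum_(n < N) \1_(A n) x).
  rewrite RintegralZl// sA; congr (_ * _); apply: eq_bigr => n _.
  by rewrite /Rintegral integral_indic// setIT.
have -> : K + N%:R * (C * (1 + m)) = \int[P]_x (cst K x + C * \sum_(n < N) (1 + G n x)).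
  rewrite RintegralD//; last exact: (integrableZl measurableT C isG).
  rewrite RintegralZl// sG Rintegral_cst// [fine (P setT)](_ : _ = 1) ?mulr1; last first.
    by rewrite probability_setT.
  congr (_ + _); rewrite (eq_bigr (fun=> 1 + m)) => [|n _].
    by rewrite sumr_const card_ord -[_ *+ N]mulr_natl; ring.
  rewrite RintegralD// Rintegral_cst// [fine (P setT)](_ : _ = 1) ?mulr1; last first.
    by rewrite probability_setT.
  by rewrite /Rintegral intG.
apply: ae_le_Rintegral => //.
- exact: (integrableZl measurableT c isA).
- exact: (integrableD measurableT iK (integrableZl measurableT C isG)).
Qed.

Section random_coordinates.
Context {R : realType} {dsp : measure_display} {Omega : measurableType dsp}.
Context {X : vectType R}.

Lemma random_vector_coord (v : Omega -> X) (i : 'I_(dim X)) :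
  random_vector v -> measurable_fun setT (fun w => v2r (v w) 0 i).
Proof.
move=> rv; pose l (u : X) : R^o := v2r u 0 i.
have lin_l : linear l by move=> a u w; rewrite /l linearP !mxE.
pose ll : {linear X -> R^o} := HB.pack l (GRing.isLinear.Build R X R^o _ l lin_l).
exact: (rv ll).
Qed.

Lemma measurable_S_half (S : nat -> Omega -> X) n :
  (forall n, random_vector (S n)) ->
  measurable_fun setT (fun w => v2r (S_half S n w)).
Proof.
move=> rS; apply: measurable_fun_mx => j i; rewrite ord1.
under eq_fun do rewrite /S_half /mid linearZ linearD !mxE.
by apply: measurable_funM => //; apply: measurable_funD; exact: random_vector_coord.
Qed.

End random_coordinates.

Section tightness.
Context {R : realType} {dsp : measure_display} {Omega : measurableType dsp}.
Variables (P : probability Omega R) (F : R -> set (set Omega)) (W : R -> Omega -> R).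
Hypotheses (hF : usual_filtration P F) (hW : wiener P F W).
Context {d : nat} (O : polygonal_domain R d) {X Y : vectType R}.
Variables (D : gd_data d X Y) (p kappa tau : R).
Hypotheses (hp : 1 < p) (hD : is_gd O D p) (hkappa : 0 <= kappa) (htau : 0 < tau).
Variables (g sigma : 'rV[R]_d -> 'rV[R]_d).
Hypotheses (hg : vsobolev O 1 +oo%E g) (hsigma : vsobolev O 1 +oo%E sigma).
Variables (vin : L2 O) (S : nat -> Omega -> X) (Q : nat -> Omega -> Y).
Hypothesis hS : solution D p kappa tau g sigma P W vin S Q.

Notation dW n w := (W (n.+1%:R * tau) w - W (n%:R * tau) w).

(** Kinetic energies telescope; the initial one is bounded by the energy of the
initial datum, and the final one is dropped. *)
Lemma path_energy : exists c K C : R, [/\ 0 < c, 0 <= K, 0 <= C &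
  \forall w \ae P, forall N,
    c * \sum_(n < N) `|v2r (S_half S n w)| <=
    K + C * \sum_(n < N) (1 + `|dW n w| `^ conj_exp p)].
Proof.
have [c [C [c0 C0 hstep]]] := time_step_energy hp hD hkappa htau hg hsigma.
pose K := pairing_mx O (L2rep vin) (L2rep vin).
have K0 : 0 <= K by apply: Rintegral_ge0 => x _; rewrite mxdotxx sqr_ge0.
exists c, K, C; split=> //.
have := ae_foralln (sol_step hS); apply: filterS => w hw.
have YQ N : Y0 O D (Q N w).
  by case: N => [|N]; [have [] := sol_init hS w|have [] := hw N].
suff H N : kinetic O D (S N w) + c * \sum_(n < N) `|v2r (S_half S n w)| <=
    K + C * \sum_(n < N) (1 + `|dW n w| `^ conj_exp p).
  by move=> N; have := H N; have := kinetic_ge0 O D (S N w); lra.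
elim: N => [|N IH].
  rewrite !big_ord0 !mulr0 !addr0; exact: (init_step_energy hD (sol_init hS w)).
rewrite !big_ord_recr /= !mulrDr.
have := hstep _ _ _ _ _ (YQ N) (hw N); rewrite -/(S_half S N w).
rewrite mulrDr; lra.
Qed.

(** Each time the midpoint leaves the ball of radius r, it uses up at least c * r
of a budget whose expectation grows linearly with the number of steps. *)
Lemma average_tail (x : nat -> {mfun Omega >-> 'rV[R]_(dim X)}) :
  (forall n w, x n w = v2r (S_half S n w)) ->
  forall e : R, 0 < e -> exists r : R, forall k,
    (avg_law P x k [set z : 'rV[R]_(dim X) | (r < `|z|)%R] <= e%:E)%E.
Proof.
move=> xE e e0.
have [c [K [C [c0 K0 C0 hpath]]]] := path_energy.
have q0 : 0 < conj_exp p by rewrite divr_gt0 ?subr_gt0// (lt_trans ltr01).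
pose G n w := `|dW n w| `^ conj_exp p.
have m_lty : (\int[normal_prob 0 (Num.sqrt tau)]_y (`|y| `^ conj_exp p)%:E < +oo)%E.
  by apply: normal_prob_moment => //; rewrite sqrtr_gt0.
pose m := fine (\int[normal_prob 0 (Num.sqrt tau)]_y (`|y| `^ conj_exp p)%:E)%E.
have m0 : 0 <= m by rewrite fine_ge0// integral_ge0// => y _; rewrite lee_fin powR_ge0.
have nt0 n : 0 <= n%:R * tau by rewrite mulr_ge0// ltW.
have mdW n : measurable_fun setT (fun w => dW n w).
  by apply: measurable_funB; apply: (measurable_wiener hF hW) => //; exact: nt0.
have mG n : measurable_fun setT (G n) by exact: measurable_norm_powR.
have intG n : (\int[P]_w (G n w)%:E = m%:E)%E.
  rewrite /m fineK; last first.
    by rewrite ge0_fin_numE// integral_ge0// => y _; rewrite lee_fin powR_ge0.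
  rewrite -(wiener_increment_moment hF hW _ (nt0 n) htau); apply: eq_integral => w _.
  by rewrite /G -natr1 mulrDl mul1r.
(* For this radius the tail bound (K + C (1 + m)) / (c r) is below e. *)
pose r := (K + C * (1 + m)) / (c * e) + 1.
have ce0 : 0 < c * e by rewrite mulr_gt0.
have r0 : 0 < r.
  by rewrite ltr_wpDl// divr_ge0 ?addr_ge0 ?mulr_ge0 ?addr_ge0// ltW.
exists r => k.
pose A n : set Omega := [set w | r < `|x n w|].
have mZ := @measurable_norm_gt R (dim X) r.
have mA n : measurable (A n).
  by rewrite /A -[X in measurable X]setTI; exact: (measurable_funPT (x n) measurableT _ mZ).
have hA : \forall w \ae P, c * r * \sum_(n < k.+1) \1_(A n) w <=
    K + C * \sum_(n < k.+1) (1 + G n w).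
  apply: filterS hpath => w /(_ k.+1); apply: le_trans.
  rewrite -mulrA ler_wpM2l ?(ltW c0)// mulr_sumr; apply: ler_sum => n _.
  rewrite indicE; case: (boolP (w \in A n)) => [/set_mem/= h|_].
    by rewrite mulr1 -xE ltW.
  by rewrite mulr0.
have := sum_probability_le mA mG (fun n w => powR_ge0 _ _) intG hA.
rewrite avg_lawE; set s := \sum_(n < k.+1) fine _ => hs.
have -> : (\sum_(n < k.+1) P (x n @^-1` [set z | (r < `|z|)%R]) = s%:E)%E.
  rewrite /s -sumEFin; apply: eq_bigr => n _.
  by rewrite fineK ?fin_num_measure//; exact: mA.
rewrite -EFinM lee_fin ler_pdivrMl//.
have N1 : 1 <= k.+1%:R :> R by rewrite ler1n.
rewrite -(ler_pM2l (mulr_gt0 c0 r0)); apply: (le_trans hs).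
have -> : c * r * (k.+1%:R * e) = k.+1%:R * (K + C * (1 + m) + c * e).
  by rewrite /r; field; rewrite !gt_eqF.
have h1 : K <= k.+1%:R * K by rewrite ler_peMl.
have h2 : 0 <= k.+1%:R * (c * e) by rewrite mulr_ge0// ltW.
by rewrite !mulrDr in h1 h2 *; lra.
Qed.

End tightness.

(** * Existence of a limit measure *)

Theorem lemma21 (R : realType) (dsp : measure_display)
  (Omega : measurableType dsp) (P : probability Omega R)
  (F : R -> set (set Omega)) (hF : usual_filtration P F)
  (W : R -> Omega -> R) (hW : wiener P F W)
  (d : nat) (O : polygonal_domain R d)
  (p : R) (hp : 1 < p) (kappa : R) (hkappa : 0 <= kappa)
  (tau : R) (htau : 0 < tau)
  (g : 'rV[R]_d -> 'rV[R]_d) (hg : sobolev_div O 2 g)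
  (sigma : 'rV[R]_d -> 'rV[R]_d) (hsigma : sobolev_div O 1 sigma)
  (X Y : vectType R) (D : gd_data d X Y) (hD : is_gd O D p)
  (Gamma : R) (hGamma : gd_stable O D p Gamma)
  (vin : L2 O) (S : nat -> Omega -> X) (Q : nat -> Omega -> Y)
  (hS : solution D p kappa tau g sigma P W vin S Q) :
  exists (Nk : nat -> nat) (mu : probability (L2 O) R),
    [/\ forall k, (0 < Nk k)%N,
        {homo Nk : i j / (i < j)%N} &
        forall f : L2 O -> R, continuous f ->
          (exists M : R, forall v, `|f v| <= M) ->
          (\int[mu_half D P S (Nk k)]_v (f v)%:E)%E @[k --> \oo]
            --> (\int[mu]_v (f v)%:E)%E].
Proof.
have hg1 : vsobolev O 1 +oo%E g by move=> i; apply: sobolevW; have [+ _] := hg; exact.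
have hsigma1 : vsobolev O 1 +oo%E sigma by have [] := hsigma.
have mS n := measurable_S_half n (sol_measurable hS).
pose x n : {mfun Omega >-> 'rV[R]_(dim X)} := HB.pack (fun w => v2r (S_half S n w))
  (isMeasurableFun.Build _ _ _ _ (fun w => v2r (S_half S n w)) (mS n)).
have [phi [mu0 [phi_incr mu0P]]] := prokhorov_rV
  (@average_tail _ _ _ _ _ _ hF hW _ _ _ _ _ _ _ _ hp hD hkappa htau _ _
     hg1 hsigma1 _ _ _ hS x (fun _ _ => erefl)).
pose J : {mfun 'rV[R]_(dim X) >-> L2 O} := HB.pack (reconstruct O D)
  (isMeasurableFun.Build _ _ _ _ (reconstruct O D) (measurable_reconstruct hD)).
exists (fun k => (phi k).+1), (distribution mu0 J); split=> [//|i j /phi_incr|f cf [M fM]].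
  by [].
have mf : measurable_fun setT f := measurable_continuous_L2 cf.
have cfJ : continuous (f \o J).
  by move=> z; apply: continuous_comp; [exact: (continuous_reconstruct hD)|exact: cf].
have fJM z : `|(f \o J) z| <= M by exact: fM.
have mfJ := continuous_measurable_rV cfJ.
have mEf : measurable_fun setT (EFin \o f) by exact/measurable_EFinP.
rewrite integral_distribution//; last exact: integrable_bounded_fun mfJ fJM.
rewrite (_ : (fun k => _) = fun k => (\int[avg_law P x (phi k)]_z ((f \o J) z)%:E)%E).
  by apply: mu0P => //; exists M.
apply/funext => k.
(* The index of [avg_law] counts from zero. *)
have -> : mu_half D P S (phi k).+1 = distribution (avg_law P x (phi k)) J.
  apply/funext => A; rewrite [RHS](avg_lawE P x (phi k) (J @^-1` A)) /mu_half.
  congr (_ * _)%E; apply: eq_bigr => n _; congr (P _).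
  by apply/seteqP; split => w /=; rewrite /reconstruct v2rK.
by rewrite integral_distribution//; exact: integrable_bounded_fun mfJ fJM.
Qed.
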